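(* There is a deterministic algorithm that, given an $n$-vertex graph $G=(V,E)$ with maximum vertex degree $\Delta$, disjoint subsets $A_1,B_1,\ldots,A_k,B_k$ of its vertices with $|A_i|\le|B_i|$ and $|A_i|=n_i$ for all $1\le i\le k$, and integers $z\ge0$, $\ell\ge 32\Delta\log n$, computes one of the following: either a partial routing of the sets $A_1,B_1,\ldots,A_k,B_k$ of value at least $\sum_i n_i-z$ that causes congestion at most $\ell^2$; or a cut $(X,Y)$ in $G$ with $|X|,|Y|\ge z/2$ and $\Psi_G(X,Y)\le 72\Delta\log n/\ell$. The running time of the algorithm is $\tilde O(\ell^3k|E(G)|+\ell^2kn)$.
   Context: Graphs are undirected and unweighted, possibly with parallel edges but no self-loops. For a cut $(X,Y)$ of $G$, $\Psi_G(X,Y)=\frac{|E_G(X,Y)|}{\min\{|X|,|Y|\}}$, where $E_G(X,Y)$ is the set of edges between $X$ and $Y$. Given disjoint vertex subsets $A_1,B_1,\ldots,A_k,B_k$ with $|A_i|\le|B_i|$, a partial routing of them consists of a set $M=\bigcup_{i=1}^kM_i$ of vertex pairs, where each $M_i$ is a matching between vertices of $A_i$ and vertices of $B_i$ (pairs need not be edges of $G$), together with, for each pair $(u,v)\in M$, a path $P(u,v)$ in $G$ connecting $u$ to $v$. The routing causes congestion $c$ if every edge of $G$ lies on at most $c$ of these paths; its value is $\sum_i|M_i|$. $\tilde O$ hides polylogarithmic factors. *)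

(* Defs.v *)
From HB Require Import structures.
From mathcomp Require Import all_boot all_order all_algebra.
From mathcomp Require Import reals exp.

Set Implicit Arguments.
Unset Strict Implicit.
Unset Printing Implicit Defensive.

Import Order.TTheory GRing.Theory Num.Theory.

(** * Multigraphs *)

(* Undirected: the order of the two components of [ends e] is irrelevant. *)
Record multigraph (n m : nat) := Multigraph {
  ends : 'I_m -> 'I_n * 'I_n;
  loopless : forall e, (ends e).1 != (ends e).2
}.

Section Graphs.
Variables (n m : nat) (G : multigraph n m).

Definition degree (v : 'I_n) : nat :=
  #|[set e : 'I_m | ((ends G e).1 == v) || ((ends G e).2 == v)]|.

Definition max_degree : nat := \max_(v < n) degree v.

Definition edges_between (X Y : {set 'I_n}) : {set 'I_m} :=
  [set e : 'I_m | (((ends G e).1 \in X) && ((ends G e).2 \in Y))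
               || (((ends G e).1 \in Y) && ((ends G e).2 \in X))].

Definition is_cut (X Y : {set 'I_n}) : Prop :=
  [/\ X != set0, Y != set0, [disjoint X & Y] & X :|: Y = [set: 'I_n]].

Definition sparsity (R : realType) (X Y : {set 'I_n}) : R :=
  (#|edges_between X Y|%:R / (minn #|X| #|Y|)%:R)%R.

Definition joins (e : 'I_m) (u v : 'I_n) : bool :=
  (ends G e == (u, v)) || (ends G e == (v, u)).

(* A walk from [u] is the sequence of its (edge, next vertex) steps; the edges
   are recorded because of parallel edges. *)
Fixpoint is_walk (u : 'I_n) (p : seq ('I_m * 'I_n)) : bool :=
  if p is (e, w) :: p' then joins e u w && is_walk w p' else true.

Definition is_path (u v : 'I_n) (p : seq ('I_m * 'I_n)) : bool :=
  [&& is_walk u p, uniq (u :: unzip2 p) & last u (unzip2 p) == v].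

Variable k : nat.

Definition disjoint_family (A B : 'I_k -> {set 'I_n}) : Prop :=
  [/\ forall i j, [disjoint A i & B j],
      forall i j, i != j -> [disjoint A i & A j]
    & forall i j, i != j -> [disjoint B i & B j]].

(* Only used for disjoint [X] and [Y]. *)
Definition is_matching (X Y : {set 'I_n}) (M : {set 'I_n * 'I_n}) : Prop :=
  M \subset setX X Y /\
  {in M &, forall p q, p != q -> p.1 != q.1 /\ p.2 != q.2}.

Definition all_pairs (M : 'I_k -> {set 'I_n * 'I_n}) : {set 'I_n * 'I_n} :=
  \bigcup_(i < k) M i.

Definition is_partial_routing (A B : 'I_k -> {set 'I_n})
    (M : 'I_k -> {set 'I_n * 'I_n})
    (P : 'I_n * 'I_n -> seq ('I_m * 'I_n)) : Prop :=
  (forall i, is_matching (A i) (B i) (M i)) /\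
  (forall p, p \in all_pairs M -> is_path p.1 p.2 (P p)).

Definition routing_value (M : 'I_k -> {set 'I_n * 'I_n}) : nat :=
  \sum_(i < k) #|M i|.

Definition causes_congestion (M : 'I_k -> {set 'I_n * 'I_n})
    (P : 'I_n * 'I_n -> seq ('I_m * 'I_n)) (c : nat) : Prop :=
  forall e : 'I_m, #|[set p in all_pairs M | e \in unzip1 (P p)]| <= c.

End Graphs.

Definition log2 (R : realType) (n : nat) : R := (ln n%:R / ln 2)%R.

(** * Deterministic word RAM *)

(* Programs of a RAM with [w]-bit words, written as structured commands over
   numbered registers and numbered arrays.  A program mentions finitely many
   registers and arrays, and its expressions have bounded size, so charging
   one time unit per assignment, store and test is the usual unit-cost measure
   up to a factor depending on the program only. *)

Inductive binop := Add | Sub | Mul | Div | Mod | Lt | Eq.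

Inductive expr :=
| Num of nat
| Reg of nat
| Read of nat & expr
| Bin of binop & expr & expr.

Inductive cmd :=
| Skip
| Assign of nat & expr
| Store of nat & expr & expr
| Seq of cmd & cmd
| If of expr & cmd & cmd
| While of expr & cmd.

Record state := State {
  reg : nat -> nat;
  mem : nat -> nat -> nat
}.

(* Subtraction is truncated at 0; [x / 0 = 0] and [x mod 0 = x]. *)
Definition eval_binop (o : binop) (x y : nat) : nat :=
  match o with
  | Add => x + y
  | Sub => x - y
  | Mul => x * y
  | Div => x %/ y
  | Mod => x %% y
  | Lt => x < y
  | Eq => x == y
  end.

Fixpoint eval (w : nat) (s : state) (e : expr) : nat :=
  match e with
  | Num c => c %% 2 ^ w
  | Reg x => reg s x
  | Read a e1 => mem s a (eval w s e1)
  | Bin o e1 e2 => eval_binop o (eval w s e1) (eval w s e2) %% 2 ^ w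
  end.

Definition set_reg (s : state) (x v : nat) : state :=
  State (fun y => if y == x then v else reg s y) (mem s).

Definition set_mem (s : state) (a i v : nat) : state :=
  State (reg s)
    (fun b j => if (b == a) && (j == i) then v else mem s b j).

(* [exec w c s t s']: with word size [w], the command [c] started in [s] halts
   in [s'] after [t] time units. *)
Inductive exec (w : nat) : cmd -> state -> nat -> state -> Prop :=
| ExecSkip s : exec w Skip s 0 s
| ExecAssign x e s : exec w (Assign x e) s 1 (set_reg s x (eval w s e))
| ExecStore a e1 e2 s :
    exec w (Store a e1 e2) s 1 (set_mem s a (eval w s e1) (eval w s e2))
| ExecSeq c1 c2 s t1 s1 t2 s2 :
    exec w c1 s t1 s1 -> exec w c2 s1 t2 s2 ->
    exec w (Seq c1 c2) s (t1 + t2) s2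
| ExecIf e c1 c2 s t s1 :
    exec w (if eval w s e != 0 then c1 else c2) s t s1 ->
    exec w (If e c1 c2) s t.+1 s1
| ExecWhileEnd e c s :
    eval w s e = 0 -> exec w (While e c) s 1 s
| ExecWhile e c s t1 s1 t2 s2 :
    eval w s e != 0 ->
    exec w c s t1 s1 -> exec w (While e c) s1 t2 s2 ->
    exec w (While e c) s (t1 + t2).+1 s2.

Lemma exec_deterministic w c s t1 s1 t2 s2 :
  exec w c s t1 s1 -> exec w c s t2 s2 -> t1 = t2 /\ s1 = s2.
Proof.
move=> H; elim: H t2 s2 => {c s t1 s1}.
- by move=> s t2 s2 H; inversion H.
- by move=> x e s t2 s2 H; inversion H.
- by move=> a e1 e2 s t2 s2 H; inversion H.
- move=> c1 c2 s t1 s1 t2 s2 _ IH1 _ IH2 t3 s3 H.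
  inversion H as [| | |? ? ? ? ? ? ? K1 K2| | |]; subst.
  by have [-> E] := IH1 _ _ K1; subst; have [-> ->] := IH2 _ _ K2.
- move=> e c1 c2 s t s1 _ IH t3 s3 H.
  inversion H as [| | | |? ? ? ? ? ? K| |]; subst.
  by have [-> ->] := IH _ _ K.
- move=> e c s e0 t3 s3 H.
  inversion H as [| | | | | |? ? ? ? ? ? ? K]; subst => //.
  by move: K; rewrite e0.
- move=> e c s t1 s1 t2 s2 en _ IH1 _ IH2 t3 s3 H.
  inversion H as [| | | | |? ? ? K|? ? ? ? ? ? ? _ K1 K2]; subst.
    by move: en; rewrite K.
  by have [-> E] := IH1 _ _ K1; subst; have [-> ->] := IH2 _ _ K2.
Qed.

(** * Input and output conventions *)

Section InputOutput.
Variables (n m k : nat).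

(* A family of disjoint sets is given by the array sending a vertex to one
   plus the index of the set containing it, or to 0 if there is none. *)
Definition label (A : 'I_k -> {set 'I_n}) (v : 'I_n) : nat :=
  if [pick i | v \in A i] is Some i then (val i).+1 else 0.

(* Registers 0-4 hold n, m, k, l, z.  Arrays 0 and 1 hold the endpoints of the
   edges, arrays 2 and 3 the labels of the vertices for A and for B.  All
   other registers and cells are 0. *)
Definition input (G : multigraph n m) (A B : 'I_k -> {set 'I_n})
    (z l : nat) : state :=
  State
    (fun x => nth 0 [:: n; m; k; l; z] x)
    (fun a i => nth 0 (nth [::]
       [:: [seq val (ends G e).1 | e <- enum 'I_m];
           [seq val (ends G e).2 | e <- enum 'I_m];
           [seq label A v | v <- enum 'I_n];
           [seq label B v | v <- enum 'I_n]] a) i).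

Definition array_holds (s : state) (a : nat) (xs : seq nat) : Prop :=
  forall i, i < size xs -> mem s a i = nth 0 xs i.

(* Register 0 is 1 and array 0 holds the indicator function of X. *)
Definition outputs_cut (s : state) (X : {set 'I_n}) : Prop :=
  reg s 0 = 1 /\ array_holds s 0 [seq nat_of_bool (v \in X) | v <- enum 'I_n].

(* Register 0 is 0 and register 1 is the number of pairs.  Arrays 0, 1 and 2
   list the first elements and the second elements of the pairs, and the
   lengths of their paths; arrays 3 and 4 hold the concatenations of the edge
   sequences and of the vertex sequences (without starting points) of the
   paths. *)
Definition outputs_routing (s : state) (M : 'I_k -> {set 'I_n * 'I_n})
    (P : 'I_n * 'I_n -> seq ('I_m * 'I_n)) : Prop :=
  reg s 0 = 0 /\
  exists ps : seq ('I_n * 'I_n),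
    uniq ps /\ ps =i all_pairs M /\
    reg s 1 = size ps /\
    array_holds s 0 [seq val p.1 | p <- ps] /\
    array_holds s 1 [seq val p.2 | p <- ps] /\
    array_holds s 2 [seq size (P p) | p <- ps] /\
    array_holds s 3 [seq val q.1 | q <- flatten [seq P p | p <- ps]] /\
    array_holds s 4 [seq val q.2 | q <- flatten [seq P p | p <- ps]].

End InputOutput.

(* Main.v *)
Require Import Defs.
From HB Require Import structures.
From mathcomp Require Import all_boot all_order all_algebra.
From mathcomp Require Import reals exp.
From mathcomp Require Import zify.
(* The libraries shadow [Num] and [Lt]. *)
Import Defs.

(* Let L be the integer part of log n. The algorithm works in at most L rounds,
    giving each edge capacity l^2 / L in each of them. In a round, for each i in
    turn, it joins unrouted vertices of A_i to B_i by paths of length at most l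
    along unsaturated edges, found by depth-first search with labels that are
    lower bounds on the distance to B_i and only increase. In the end every
    unrouted vertex of A_i has label l + 1, the unused ones of B_i have label 0,
    and labels of adjacent vertices along unsaturated edges differ by at most 1.
    Ball growing in the levels of the labels then yields a set containing all
    the former or all the latter vertices, of at most half of the remaining
    vertices, with at most 8 Delta L / l unsaturated boundary edges per vertex;
    it is added to X and removed, unless X already has n/4 vertices.

    If a round routes at least half of the N remaining sources, the next one
    starts, so L rounds suffice. Otherwise the paths of the round have total
    length at most l N', where N' sources remain, so they saturate O(N' L / l)
    edges, and since N' = O(|X|), X is a sparse cut. A pointer into each adjacency
    list, reset only when the label of its vertex grows, makes the search linear
    in l (n + m). *)

Set Implicit Arguments.
Unset Strict Implicit.
Unset Printing Implicit Defensive.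

Import Order.TTheory GRing.Theory Num.Theory.

(** * Reasoning about RAM programs *)

(** Rounds make the charging work. With all l^2 units granted at once, the saturated edges would
    have to be charged to all sources routed so far, possibly far more than remain. A round that
    fails to halve its N0 sources routes fewer paths than the N sources it leaves, so N pays for the
    saturated edges. Within a round there are no reversed residual arcs: capacities only drop and
    targets only disappear, so distances to the targets only grow and no label is ever lowered.
    Constants: X stops growing at n/4 vertices and an addition takes at most half of the rest, so
    |X| <= 5n/8 and |X| is at most 5/3 of the smaller side. There are at most 8 Delta L |X| / l
    unsaturated and 4 Delta L |X| / l saturated boundary edges, together at most 20 Delta L / l per
    vertex of the smaller side, below the allowed 72. If X stays below n/4, it contains one side of
    what remains of every pair of sets, hence N <= |X|; otherwise N <= n/2 <= 2|X|. Either way z < N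
    <= 2|X|. *)

Fixpoint evalN (s : state) (e : expr) : nat :=
  match e with
  | Num c => c
  | Reg x => reg s x
  | Read a e1 => mem s a (evalN s e1)
  | Bin o e1 e2 => eval_binop o (evalN s e1) (evalN s e2)
  end.

(** No operation wraps around: overflow becomes a side condition, and programs are otherwise
    analysed over the natural numbers. Comparisons yield 0 or 1 and need only one bit. *)
Fixpoint fits (w : nat) (s : state) (e : expr) : Prop :=
  match e with
  | Num c => c < 2 ^ w
  | Reg _ => True
  | Read _ e1 => fits w s e1
  | Bin o e1 e2 =>
      [/\ fits w s e1, fits w s e2 &
          match o with
          | Lt | Eq => 1 < 2 ^ w
          | o => eval_binop o (evalN s e1) (evalN s e2) < 2 ^ w
          end]
  end.

Lemma eval_fits w s e : fits w s e -> eval w s e = evalN s e.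
Proof.
elim: e => //= [c H|a e1 IH H|o e1 IH1 e2 IH2 [H1 H2 H3]].
- by rewrite modn_small.
- by rewrite IH.
- rewrite IH1 // IH2 // modn_small //.
  by case: o H3 => //= H; apply: leq_ltn_trans H; apply: leq_b1.
Qed.

Definition spec w c s (Q : nat -> state -> Prop) : Prop :=
  exists t s', exec w c s t s' /\ Q t s'.

Lemma spec_conseq w c s (Q Q' : nat -> state -> Prop) :
  spec w c s Q -> (forall t s', Q t s' -> Q' t s') -> spec w c s Q'.
Proof. by move=> [t [s' [H HQ]]] QQ; exists t, s'; split=> //; apply: QQ. Qed.

Lemma spec_skip w s (Q : nat -> state -> Prop) : Q 0 s -> spec w Skip s Q.
Proof. by move=> H; exists 0, s; split=> //; constructor. Qed.

Lemma spec_assign w x e s (Q : nat -> state -> Prop) :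
  fits w s e -> Q 1 (set_reg s x (evalN s e)) -> spec w (Assign x e) s Q.
Proof.
move=> He H; exists 1, (set_reg s x (eval w s e)); split; first by constructor.
by rewrite eval_fits.
Qed.

Lemma spec_store w a e1 e2 s (Q : nat -> state -> Prop) :
  fits w s e1 -> fits w s e2 -> Q 1 (set_mem s a (evalN s e1) (evalN s e2)) ->
  spec w (Store a e1 e2) s Q.
Proof.
move=> H1 H2 H; exists 1, (set_mem s a (eval w s e1) (eval w s e2)).
by split; [constructor | rewrite !eval_fits].
Qed.

Lemma spec_seq w c1 c2 s (Q : nat -> state -> Prop) :
  spec w c1 s (fun t1 s1 => spec w c2 s1 (fun t2 s2 => Q (t1 + t2) s2)) ->
  spec w (Seq c1 c2) s Q.
Proof.
move=> [t1 [s1 [H1 [t2 [s2 [H2 H]]]]]]; exists (t1 + t2), s2; split=> //.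
exact: ExecSeq H1 H2.
Qed.

Lemma spec_if w e c1 c2 s (Q : nat -> state -> Prop) :
  fits w s e ->
  (evalN s e != 0 -> spec w c1 s (fun t => Q t.+1)) ->
  (evalN s e = 0 -> spec w c2 s (fun t => Q t.+1)) ->
  spec w (If e c1 c2) s Q.
Proof.
move=> He H1 H2; case: (eqVneq (evalN s e) 0) => E.
- have [t [s' [H HQ]]] := H2 E; exists t.+1, s'; split=> //.
  by constructor; rewrite eval_fits // E eqxx.
- have [t [s' [H HQ]]] := H1 E; exists t.+1, s'; split=> //.
  by constructor; rewrite eval_fits // E.
Qed.

(** * Frame conditions for commands *)

Fixpoint wregs (c : cmd) : seq nat :=
  match c with
  | Assign x _ => [:: x]
  | Seq c1 c2 | If _ c1 c2 => wregs c1 ++ wregs c2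
  | While _ c1 => wregs c1
  | _ => [::]
  end.

Fixpoint wmems (c : cmd) : seq nat :=
  match c with
  | Store a _ _ => [:: a]
  | Seq c1 c2 | If _ c1 c2 => wmems c1 ++ wmems c2
  | While _ c1 => wmems c1
  | _ => [::]
  end.

Definition same (c : cmd) (s s' : state) : Prop :=
  (forall x, x \notin wregs c -> reg s' x = reg s x) /\
  (forall a, a \notin wmems c -> mem s' a = mem s a).

Lemma exec_same w c s t s' : exec w c s t s' -> same c s s'.
Proof.
elim=> {c s t s'}; rewrite /same /=.
- by [].
- by move=> x e s; split=> // y; rewrite inE => /negbTE /= ->.
- by move=> a e1 e2 s; split=> // b; rewrite inE => /negbTE /= ->.
- move=> c1 c2 s t1 s1 t2 s2 _ [R1 M1] _ [R2 M2].
  split=> x; rewrite mem_cat negb_or => /andP [H1 H2].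
    by rewrite R2 // R1.
  by rewrite M2 // M1.
- move=> e c1 c2 s t s1 _ [R M].
  split=> x; rewrite mem_cat negb_or => /andP [H1 H2].
    by apply: R; case: ifP.
  by apply: M; case: ifP.
- by [].
- move=> e c s t1 s1 t2 s2 _ _ [R1 M1] _ [R2 M2].
  split=> x H; first by rewrite R2 // R1.
  by rewrite M2 // M1.
Qed.

Lemma spec_same w c s (Q : nat -> state -> Prop) :
  spec w c s Q -> spec w c s (fun t s' => same c s s' /\ Q t s').
Proof.
by move=> [t [s' [H HQ]]]; exists t, s'; split=> //; split=> //; apply: exec_same H.
Qed.

Lemma same_refl c s : same c s s. Proof. by []. Qed.

Lemma same_trans c s1 s2 s3 : same c s1 s2 -> same c s2 s3 -> same c s1 s3.
Proof.
move=> [R1 M1] [R2 M2]; split=> x H; first by rewrite R2 // R1.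
by rewrite M2 // M1.
Qed.

(* [mu] is a potential measured in time units, so that costs can be amortised
   over the iterations. *)
Lemma spec_while w e c s0 (I : state -> Prop) (mu : state -> nat) :
  I s0 ->
  (forall s, same c s0 s -> I s -> fits w s e) ->
  (forall s, same c s0 s -> I s -> evalN s e != 0 ->
     spec w c s (fun t s' => I s' /\ t.+1 + mu s' <= mu s)) ->
  spec w (While e c) s0
    (fun t s' => [/\ same c s0 s', I s', evalN s' e = 0
                   & t + mu s' <= (mu s0).+1]).
Proof.
move=> I0 Hf Hb.
suff: forall k s, mu s <= k -> same c s0 s -> I s ->
  spec w (While e c) s
    (fun t s' => [/\ same c s0 s', I s', evalN s' e = 0
                   & t + mu s' <= (mu s).+1]).
  by move/(_ (mu s0) s0 (leqnn _) (same_refl _ _) I0).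
have stop s : same c s0 s -> I s -> evalN s e = 0 ->
  spec w (While e c) s
    (fun t s' => [/\ same c s0 s', I s', evalN s' e = 0
                   & t + mu s' <= (mu s).+1]).
  move=> S0 Is E; exists 1, s; split=> //.
  by apply: ExecWhileEnd; rewrite eval_fits //; apply: Hf.
elim=> [|k IH] s Hk S0 Is.
all: case: (eqVneq (evalN s e) 0) => E; first exact: stop.
- by have [t [s' [_ [_]]]] := Hb s S0 Is E; lia.
- have [t [s' [X [Is' Ht]]]] := Hb s S0 Is E.
  have S' : same c s0 s' := same_trans S0 (exec_same X).
  have [|t2 [s2 [X2 [S2 I2 E2 Ht2]]]] := IH s' _ S' Is'; first by lia.
  exists (t + t2).+1, s2; split; last by split=> //; lia.
  by apply: ExecWhile X X2; rewrite eval_fits //; apply: Hf.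
Qed.

(** [K] bounds the body alone; the extra unit in [K.+1] pays for the loop test, and [mu] carries
    amortised cost as in [spec_while]. *)
Lemma spec_for w x b c s0 x0 B K (I : nat -> state -> Prop) (mu : state -> nat) :
  I x0 s0 -> x0 <= B -> reg s0 x = x0 ->
  1 < 2 ^ w ->
  (forall s, same c s0 s -> fits w s b /\ evalN s b = B) ->
  (forall s i, same c s0 s -> I i s -> x0 <= i -> i < B -> reg s x = i ->
     spec w c s
       (fun t s' => [/\ I i.+1 s', reg s' x = i.+1 & t + mu s' <= K + mu s])) ->
  spec w (While (Bin Lt (Reg x) b) c) s0
    (fun t s' => [/\ same c s0 s', I B s', reg s' x = B
                   & t + mu s' <= (B - x0) * K.+1 + mu s0 + 1]).
Proof.
move=> I0 x0B E0 W1 Hb Hc.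
pose J s := [/\ I (reg s x) s, x0 <= reg s x & reg s x <= B].
pose nu s := (B - reg s x) * K.+1 + mu s.
apply: spec_conseq (@spec_while w _ c s0 J nu _ _ _) _.
- by rewrite /J E0.
- by move=> s S _ /=; have [] := Hb s S.
- move=> s S [Is x0s sB] /=; rewrite (Hb s S).2.
  case: ltnP => // lt _.
  apply: spec_conseq (Hc s _ S Is x0s lt erefl) _ => t s' [I' E' Ht].
  rewrite /J /nu E'; split; first by split=> //; lia.
  rewrite -(subnSK lt) mulSn; lia.
- move=> t s' [S [I' H1 H2]] /=; rewrite (Hb s' S).2.
  case: ltnP => // H3 _; have E: reg s' x = B by lia.
  by rewrite /nu E E0 subnn mul0n => Ht; rewrite E in I'; split=> //; lia.
Qed.

Notation "c1 ;; c2" := (Seq c1 c2) (at level 90, right associativity).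

Lemma spec_seq_assign w x e c s (Q : nat -> state -> Prop) :
  fits w s e ->
  spec w c (set_reg s x (evalN s e)) (fun t => Q t.+1) ->
  spec w (Assign x e ;; c) s Q.
Proof. by move=> He H; apply: spec_seq; apply: spec_assign. Qed.

Lemma spec_seq_store w a e1 e2 c s (Q : nat -> state -> Prop) :
  fits w s e1 -> fits w s e2 ->
  spec w c (set_mem s a (evalN s e1) (evalN s e2)) (fun t => Q t.+1) ->
  spec w (Store a e1 e2 ;; c) s Q.
Proof. by move=> H1 H2 H; apply: spec_seq; apply: spec_store. Qed.

Lemma spec_seq_same w c1 c2 s (Q1 Q : nat -> state -> Prop) :
  spec w c1 s Q1 ->
  (forall t1 s1, same c1 s s1 -> Q1 t1 s1 ->
     spec w c2 s1 (fun t2 s2 => Q (t1 + t2) s2)) ->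
  spec w (c1 ;; c2) s Q.
Proof.
move=> /spec_same H1 H2; apply: spec_seq; apply: spec_conseq H1 _.
by move=> t s' [S HQ]; apply: H2.
Qed.

Definition upd (f : nat -> nat) (x v : nat) : nat -> nat :=
  fun y => if y == x then v else f y.

Lemma upd_eq f x v : upd f x v x = v. Proof. by rewrite /upd eqxx. Qed.

Lemma upd_neq f x v y : y != x -> upd f x v y = f y.
Proof. by rewrite /upd => /negbTE ->. Qed.

Lemma nat_bool_neq0 (b : bool) : nat_of_bool b != 0 -> b.
Proof. by case: b. Qed.

Lemma nat_bool_eq0 (b : bool) : nat_of_bool b = 0 -> ~~ b.
Proof. by case: b. Qed.

Lemma nat_bool_muln (b c : bool) : b * c = b && c.
Proof. by case: b; case: c. Qed.

Ltac fits_split :=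
  simpl; repeat match goal with
  | |- and3 _ _ _ => split
  | |- True => exact I
  end.

(** * The parameters of the algorithm *)

(* Registers: 5 is [log n], 6 the capacity of an edge in one round, 7 and 8 the
   numbers of unrouted sources, now and at the start of the round, 9 tells
   whether a cut has been found, 10 is one plus the index of the current pair of
   sets, 11 the size of the cut, 12 the current source, 13 the length of its
   search path, 14 tells whether the search has succeeded, 19 and 20 are the
   numbers of recorded paths and of their edges, 21 is a level, 22 the number of
   vertices up to this level and 23 outside the cut; 15-18 and 24 are scratch.
   Arrays: 5-7 hold the heads of the arcs and the adjacency lists, 8 and 9 the
   labels of the unrouted vertices, 10 the residual capacities, 11 the cut, 12
   the distance labels, 13 the current arcs, 14 the vertices of the search path,
   15 the sizes of the levels; the outputs 0-4 overwrite the input. *)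

Definition log_body : cmd :=
  Assign 24 (Bin Div (Reg 24) (Num 2)) ;; Assign 5 (Bin Add (Reg 5) (Num 1)).

Definition log_prog : cmd :=
  Assign 24 (Reg 0) ;;
  While (Bin Lt (Num 1) (Reg 24)) log_body ;;
  Assign 6 (Bin Div (Bin Mul (Reg 3) (Reg 3)) (Reg 5)).

Lemma log_spec w s n l :
  0 < n -> n.+1 < 2 ^ w -> l * l < 2 ^ w ->
  reg s 0 = n -> reg s 3 = l -> reg s 5 = 0 ->
  spec w log_prog s (fun t s' =>
    [/\ reg s' 5 = trunc_log 2 n, reg s' 6 = l * l %/ trunc_log 2 n
      & t <= 3 * trunc_log 2 n + 3]).
Proof.
move=> n0 nW lW E0 E3 E5; rewrite /log_prog.
apply: spec_seq_assign => //=.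
set s1 := set_reg _ _ _.
(* Register 24 is [n] divided by 2 to the number of halvings so far, rounded down. *)
pose I s := [/\ 0 < reg s 24, reg s 24 * 2 ^ reg s 5 <= n &
              n < (reg s 24).+1 * 2 ^ reg s 5].
pose mu s := 3 * (trunc_log 2 n - reg s 5).
have II s' : I s' -> reg s' 5 <= trunc_log 2 n.
  move=> [H1 H2 _]; apply: trunc_log_max => //.
  by apply: leq_trans H2; rewrite leq_pmull.
apply: spec_seq_same; first apply: (@spec_while w _ _ s1 I mu).
- by rewrite /I /= E0 E5 !muln1; split.
- by move=> s' _ _ /=; split=> //; lia.
- move=> s' _ Is' /= H; have [H1 H2 H3] := Is'.
  have {H} H : 1 < reg s' 24 by case: ltnP H.
  have H24 : reg s' 24 <= n.
    by apply: leq_trans H2; rewrite leq_pmulr // expn_gt0.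
  have HL := II _ Is'.
  have Lt : trunc_log 2 n < n by apply: leq_trans (ltn_expl _ _) (trunc_logP _ n0).
  rewrite /log_body; apply: spec_seq_assign => /=; first by split=> //; lia.
  apply: spec_assign => /=; first by split=> //; lia.
  have I' : I (set_reg (set_reg s' 24 (reg s' 24 %/ 2)) 5 (reg s' 5 + 1)).
    rewrite /I /= addn1 expnS; split; first lia.
      rewrite mulnA; apply: leq_trans H2; rewrite leq_mul2r; apply/orP; right; lia.
    apply: leq_trans H3 _; rewrite mulnA leq_mul2r; apply/orP; right; lia.
  by split=> //; have := II _ I'; rewrite /mu /=; lia.
- move=> t1 s2 S1 [_ Is2 /= E2 Ht].
  have [H1 H2 H3] := Is2; have E24 : reg s2 24 = 1 by lia.
  rewrite E24 in H2 H3.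
  have EL : reg s2 5 = trunc_log 2 n.
    by symmetry; apply: trunc_log_eq => //; rewrite expnS; lia.
  have E3' : reg s2 3 = l by rewrite S1.1.
  apply: spec_assign => /=.
    rewrite E3'; split=> //; apply: leq_ltn_trans lW; exact: leq_div.
  rewrite E3' EL; split=> //; move: Ht; rewrite /mu /= E5; lia.
Qed.

(** * Distance labels *)

Definition holds (f : nat -> nat) (xs : seq nat) : Prop :=
  forall i, i < size xs -> f i = nth 0 xs i.

Lemma holds_rcons f xs v : holds f xs -> holds (upd f (size xs) v) (rcons xs v).
Proof.
move=> H i; rewrite size_rcons ltnS nth_rcons /upd => Hi.
by case: ltngtP Hi => // Hi _; apply: H.
Qed.

Lemma holds_cat f xs ys : holds f (xs ++ ys) -> holds f xs.
Proof.
by move=> H i Hi; rewrite H ?nth_cat ?Hi // size_cat; apply: ltn_addr.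
Qed.

Definition arc_edge (p : nat) : nat := (p - 1) %/ 2.

(* Edge [e] is represented by the two arcs [2e+1] and [2e+2]; 0 is not an arc,
   and serves as the null pointer. *)
Definition is_arc (m p : nat) : bool := 0 < p <= 2 * m.

(* The list of the arcs with a given tail is linked in decreasing order. *)
Definition adj_lists (n q : nat) (tl head nxt : nat -> nat) : Prop :=
  (forall v, v < n ->
     [/\ head v <= q, 0 < head v -> tl (head v) = v
       & forall p, 0 < p <= q -> tl p = v -> p <= head v]) /\
  (forall p, 0 < p <= q ->
     [/\ nxt p < p, 0 < nxt p -> tl (nxt p) = tl p
       & forall p', nxt p < p' < p -> tl p' <> tl p]).

Lemma adj_lists_rcons n q tl head nxt :
  adj_lists n q tl head nxt -> tl q.+1 < n ->
  adj_lists n q.+1 tl (upd head (tl q.+1) q.+1) (upd nxt q.+1 (head (tl q.+1))).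
Proof.
move=> [H1 H2] tn; split.
- move=> v vn; have [A1 A2 A3] := H1 _ vn; rewrite /upd; case: eqP => [->|E].
    by split=> // p /andP [].
  split=> [|//|p /andP [p0 pq] E']; first by lia.
  apply: A3 => //; rewrite p0 /=.
  by case: ltngtP pq => // Ep _; rewrite Ep in E'; case: E.
- move=> p /andP [p0 pq]; have [A1 A2 A3] := H1 _ tn.
  rewrite /upd; case: eqP => [->|Ep]; last by apply: H2; lia.
  split=> // p' Hp' E'; have := A3 p' _ E'; lia.
Qed.

Section Labels.
Variables (n m l : nat) (tl hd head nxt : nat -> nat).
Hypothesis tl_lt : forall p, is_arc m p -> tl p < n.
Hypothesis tl_hd : forall p, is_arc m p -> tl p <> hd p.
Hypothesis adj : adj_lists n (2 * m) tl head nxt.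

(* [r] are residual capacities, [d] the labels, [ptr] the current arcs, and the
   targets are the vertices marked [i] by [lb]. *)
Definition labelling (i : nat) (r d ptr lb : nat -> nat) : Prop :=
  [/\ forall p, is_arc m p -> 0 < r (arc_edge p) -> d (tl p) <= (d (hd p)).+1,
      forall v, v < n -> lb v = i -> d v = 0,
      forall p, is_arc m p -> ptr (tl p) < p -> 0 < r (arc_edge p) ->
        d (tl p) <> (d (hd p)).+1,
      forall v, v < n -> ptr v <= 2 * m /\ (0 < ptr v -> tl (ptr v) = v)
    & forall v, v < n -> d v <= l.+1].

Lemma labelling_init i r lb d ptr :
  (forall v, v < n -> d v = 0) -> (forall v, v < n -> ptr v = head v) ->
  labelling i r d ptr lb.
Proof.
move=> d0 ptrE; split.
- by move=> p Hp _; rewrite d0 ?tl_lt.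
- by move=> v vn _; rewrite d0.
- by move=> p Hp _ _; rewrite d0 ?tl_lt.
- by move=> v vn; rewrite ptrE //; have [] := adj.1 _ vn.
- by move=> v vn; rewrite d0.
Qed.

(** The pointer passes one arc just seen to be inadmissible, and no other arc of [v] lies between it
    and [nxt (ptr v)]. *)
Lemma labelling_advance i r d ptr lb v :
  labelling i r d ptr lb -> v < n -> 0 < ptr v ->
  ~~ ((0 < r (arc_edge (ptr v))) && (d v == (d (hd (ptr v))).+1)) ->
  labelling i r d (upd ptr v (nxt (ptr v))) lb.
Proof.
move=> [HV HB HC HP HD] vn p0 na; have [p2 tlp] := HP _ vn.
have Hp : is_arc m (ptr v) by rewrite /is_arc p0.
have [N1 N2 N3] := adj.2 _ Hp.
split=> //.
- move=> p' Hp'; rewrite /upd; case: eqP => [E lt r0 dE|_]; last exact: HC.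
  case: (ltngtP p' (ptr v)) => C.
  + by apply: (N3 p'); rewrite ?lt // tlp.
  + by apply: (HC p') => //; rewrite E.
  + by move: na; rewrite -C r0 -E dE eqxx.
- move=> u un; rewrite /upd; case: eqP => [->|_]; last exact: HP.
  by split=> [|H]; [lia | rewrite N2 // tlp].
Qed.

(** With the list exhausted, all unsaturated arcs from [v] lead to labels at least [d v], so
    [d v + 1] is still valid. Arcs into [v] can only lose admissibility, their tails having labels
    at most [d v + 1]; hence the pointers of the other vertices stay correct. *)
Lemma labelling_relabel i r d ptr lb v :
  labelling i r d ptr lb -> v < n -> ptr v = 0 -> lb v <> i -> d v <= l ->
  labelling i r (upd d v (d v).+1) (upd ptr v (head v)) lb.
Proof.
move=> [HV HB HC HP HD] vn p0 lbv dv; split.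
- move=> p Hp r0; rewrite /upd; case: (tl p =P v) => [E|_].
    case: eqP => [E'|_]; first by case: (tl_hd Hp); rewrite E.
    have := HV _ Hp r0; have := HC _ Hp; rewrite E p0.
    case/andP: (Hp) => p1 _ /(_ p1 r0); lia.
  by have := HV _ Hp r0; case: eqP => [->|//]; lia.
- move=> u un E; rewrite /upd; case: eqP => [Eu|_]; last exact: HB.
  by rewrite Eu in E.
- move=> p Hp; rewrite /upd; case: (tl p =P v) => [E|_].
    by have [_ _ /(_ p Hp E)] := adj.1 _ vn; lia.
  move=> lt r0; have := HV _ Hp r0; have := HC _ Hp lt r0.
  by case: eqP => [->|//]; lia.
- move=> u un; rewrite /upd; case: eqP => [->|_]; last exact: HP.
  by have [] := adj.1 _ vn.
- by move=> u un; rewrite /upd; case: eqP => [_|_]; [lia | apply: HD].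
Qed.

(** Losing capacity or targets only removes constraints, so the labels survive the recording of a
    path. *)
Lemma labelling_weaken i r r' d ptr lb lb' :
  labelling i r d ptr lb ->
  (forall e, e < m -> r' e <= r e) -> (forall v, v < n -> lb' v = i -> lb v = i) ->
  labelling i r' d ptr lb'.
Proof.
move=> [HV HB HC HP HD] Hr Hlb.
have r0 p : is_arc m p -> 0 < r' (arc_edge p) -> 0 < r (arc_edge p).
  move=> Hp; have /Hr : arc_edge p < m by move: Hp; rewrite /is_arc /arc_edge; lia.
  lia.
split=> //.
- by move=> p Hp /(r0 _ Hp); apply: HV.
- by move=> v vn /(Hlb _ vn); apply: HB.
- by move=> p Hp lt /(r0 _ Hp); apply: HC.
Qed.

(** [x] is the label of [v] and [y] its current arc. An arc counts once for every rise still
    possible for the label of its tail, and once more if the pointer has not passed it; so a rise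
    pays for resetting the pointer. *)
Definition vertex_potential (v x y : nat) : nat :=
  (l.+1 - x) + \sum_(p <- iota 1 (2 * m) | tl p == v) (l.+1 - x + (p <= y)).

Definition potential (d ptr : nat -> nat) : nat :=
  \sum_(v < n) vertex_potential v (d v) (ptr v).

Lemma potential_bound d ptr : potential d ptr <= l.+1 * n + l.+2 * (2 * m).
Proof.
rewrite /potential /vertex_potential big_split /=; apply: leq_add.
  have -> : l.+1 * n = \sum_(v < n) l.+1 by rewrite sum_nat_const card_ord mulnC.
  apply: leq_sum => v _.
  exact: leq_subr.
apply: (@leq_trans (\sum_(v < n) \sum_(p <- iota 1 (2 * m) | tl p == v) l.+2)).
  apply: leq_sum => v _; apply: leq_sum => p _; have := leq_b1 (p <= ptr v); lia.
rewrite (exchange_big_dep predT) //=.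
apply: (@leq_trans (\sum_(p <- iota 1 (2 * m)) l.+2)).
  apply: leq_sum => p _.
  case: (pickP (fun v : 'I_n => tl p == v)) => [v0 Hv0|H0].
    rewrite (bigD1 v0) //= big1 ?addn0 // => v /andP [/eqP E1 /eqP []].
    by apply: val_inj; rewrite /= -E1 (eqP Hv0).
  by rewrite big_pred0.
by rewrite big_const_seq count_predT size_iota iter_addn_0.
Qed.

Lemma potential_upd d ptr v x y : v < n ->
  vertex_potential v x y < vertex_potential v (d v) (ptr v) ->
  potential (upd d v x) (upd ptr v y) < potential d ptr.
Proof.
move=> vn H; rewrite /potential (bigD1 (Ordinal vn)) //= [X in _ < X](bigD1 (Ordinal vn)) //=.
rewrite !upd_eq -addSn; apply: leq_add => //; apply: leq_sum => u Hu.
by rewrite !upd_neq.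
Qed.

Lemma potential_advance d ptr v : v < n -> 0 < ptr v <= 2 * m -> tl (ptr v) = v ->
  potential d (upd ptr v (nxt (ptr v))) < potential d ptr.
Proof.
move=> vn Hp tlp; have [N1 _ _] := adj.2 _ Hp.
have -> : potential d (upd ptr v (nxt (ptr v))) =
          potential (upd d v (d v)) (upd ptr v (nxt (ptr v))).
  by apply: eq_bigr => u _; rewrite /upd; case: eqP => [->|].
apply: potential_upd => //; rewrite /vertex_potential ltn_add2l.
have Hin : ptr v \in iota 1 (2 * m) by rewrite mem_iota; lia.
rewrite (big_rem _ Hin) [X in _ < X](big_rem _ Hin) /= tlp eqxx.
rewrite -addSn; apply: leq_add; first by move: N1; case: leqP; rewrite leqnn; lia.
by apply: leq_sum => p _; rewrite leq_add2l; case: (leqP p (nxt _)) => // H; lia.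
Qed.

Lemma potential_relabel d ptr v : v < n -> ptr v = 0 -> d v <= l ->
  potential (upd d v (d v).+1) (upd ptr v (head v)) < potential d ptr.
Proof.
move=> vn p0 dv; apply: potential_upd => //; rewrite /vertex_potential -addSn.
apply: leq_add; first lia.
rewrite p0 !(big_seq_cond (fun p => tl p == v)).
apply: leq_sum => p; rewrite mem_iota => /andP [Hp _].
by have := leq_b1 (p <= head v); lia.
Qed.

End Labels.

(** * Level cuts *)

(** Growth by a factor [1 + c / l] per step doubles within [u >= l / c] steps, already by
    Bernoulli's inequality. Both sides are multiplied by [l] to avoid division. *)
Lemma doubling (f : nat -> nat) (l c u T : nat) :
  0 < l -> l <= c * u ->
  (forall i, i < T * u -> f i * (l + c) <= f i.+1 * l) ->
  2 ^ T * f 0 <= f (T * u).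
Proof.
move=> l0 lu; elim: T => [|T IH] Hf; first by rewrite mul1n.
have {}IH : 2 ^ T * f 0 <= f (T * u) by apply: IH => i Hi; apply: Hf; lia.
have step i : i <= u -> f (T * u) * (l + c * i) <= f (T * u + i) * l.
  elim: i => [|i IHi] Hi; first by rewrite muln0 !addn0.
  have {}IHi := IHi (ltnW Hi).
  have H := Hf (T * u + i) ltac:(rewrite mulSn; lia).
  have le : f (T * u) <= f (T * u + i).
    rewrite -(leq_pmul2r l0); apply: leq_trans IHi.
    by rewrite leq_mul2l leq_addr orbT.
  rewrite addnS; apply: leq_trans H; rewrite mulnS addnCA addnC !mulnDr.
  by rewrite mulnDr in IHi; apply: leq_add => //; rewrite leq_mul2r le orbT.
have H := step u (leqnn _).
have H2 : 2 * f (T * u) <= f (T * u + u).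
  rewrite -(leq_pmul2r l0); apply: leq_trans H.
  by rewrite -mulnA mulnCA leq_mul2l; apply/orP; right; lia.
by rewrite mulSnr expnS -mulnA; apply: leq_trans H2; rewrite leq_mul2l IH orbT.
Qed.

(* Otherwise the union of the [j] levels nearest to one of the two ends would
   double every [l / 8L + 1] levels until it exceeds half of the total. *)
Lemma sparse_level (cnt : nat -> nat) (l L : nat) :
  0 < l -> 0 < L -> \sum_(j < l.+2) cnt j < 2 ^ L.+1 ->
  exists2 j, j <= l &
    l * minn (cnt j) (cnt j.+1) <=
    8 * L * minn (\sum_(i < j.+1) cnt i) (\sum_(i < l.+2) cnt i - \sum_(i < j.+1) cnt i).
Proof.
move=> l0 L0; set tot := \sum_(j < l.+2) _ => Htot.
pose lo j := \sum_(i < j.+1) cnt i.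
have loS j : lo j.+1 = lo j + cnt j.+1 by rewrite /lo big_ord_recr.
have lo_mono i j : i <= j -> lo i <= lo j.
  move=> /subnKC <-; elim: (j - i) => [|k IH]; first by rewrite addn0.
  by rewrite addnS loS; apply: leq_trans IH (leq_addr _ _).
have totE : tot = lo l + cnt l.+1 by rewrite /tot big_ord_recr.
case: (pickP (fun j : 'I_l.+1 => l * minn (cnt j) (cnt j.+1) <=
    8 * L * minn (lo j) (tot - lo j))) => [j Hj|none].
  by exists j; [rewrite -ltnS; apply: ltn_ord | exact: Hj].
have {none} bad j : j <= l -> 8 * L * minn (lo j) (tot - lo j) < l * minn (cnt j) (cnt j.+1).
  move=> Hj; have := none (Ordinal (Hj : j < l.+1)) => /= /negbT.
  by rewrite -ltnNge.
have lo0 : lo 0 = cnt 0 by rewrite /lo big_ord1.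
(* The smaller of levels 0 and 1 is no larger than either side of the cut after level 0, so failure
   at [j = 0] forces this. It makes [L * u] at most half of [l]. *)
have Hl : 8 * L < l.
  have := bad 0 isT; have : minn (cnt 0) (cnt 1) <= minn (lo 0) (tot - lo 0).
    have : lo 1 <= lo l by apply: lo_mono.
    by rewrite loS; lia.
  move=> le H; rewrite ltnNge; apply/negP => le2.
  by move: H; rewrite ltnNge leq_mul.
pose u := (l %/ (8 * L)).+1.
have lu : l <= 8 * L * u by rewrite mulnC; apply/ltnW/ltn_ceil; lia.
(* The lowest and the highest [L * u + 1] levels do not overlap, so one of these blocks has at most
   half of the total, and the growth argument applies to it. *)
have Lu : 2 * (L * u) <= l.
  have := leq_divM l (8 * L); rewrite /u mulnS; lia.
have pos j : j <= l -> 0 < cnt j /\ 0 < cnt j.+1.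
  move=> /bad H; have : 0 < l * minn (cnt j) (cnt j.+1) by lia.
  by rewrite muln_gt0 => /andP [_]; lia.
exfalso; case: (leqP (lo (L * u)) (tot - lo (L * u))) => C.
- have := @doubling lo l (8 * L) u L l0 lu.
  have [c0 _] := pos 0 isT.
  have : lo (L * u) < 2 ^ L by rewrite expnS in Htot; lia.
  move=> lt; rewrite lo0 => H; suff : 2 ^ L * cnt 0 <= lo (L * u).
    move=> H2; have : 2 ^ L * 1 <= 2 ^ L * cnt 0 by rewrite leq_mul2l c0 orbT.
    lia.
  apply: H => i Hi; have := bad i.+1 ltac:(lia).
  have H1 : lo i.+1 <= lo (L * u) by apply: lo_mono.
  have -> : minn (lo i.+1) (tot - lo i.+1) = lo i.+1 by lia.
  move=> H2; have {H2} : 8 * L * lo i.+1 < l * cnt i.+1.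
    by apply: leq_trans H2 _; rewrite leq_mul2l geq_minl orbT.
  rewrite loS !mulnDr !mulnDl; nia.
(* Mirror image from above: [hi j] counts the top [j + 1] levels. *)
- pose hi j := tot - lo (l - j).
  have := @doubling hi l (8 * L) u L l0 lu.
  have [_ c0] := pos l (leqnn _).
  have hi0 : hi 0 = cnt l.+1 by rewrite /hi subn0 totE addKn.
  have lt : hi (L * u) < 2 ^ L.
    have : lo (L * u) <= lo (l - L * u) by apply: lo_mono; lia.
    by rewrite /hi; rewrite expnS in Htot; lia.
  rewrite hi0 => H; suff : 2 ^ L * cnt l.+1 <= hi (L * u).
    move=> H2; have : 2 ^ L * 1 <= 2 ^ L * cnt l.+1 by rewrite leq_mul2l c0 orbT.
    lia.
  apply: H => i Hi; rewrite /hi; have -> : l - i = (l - i.+1).+1 by lia.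
  set j := l - i.+1; have jl : j < l by rewrite /j; lia.
  have H1 : lo (L * u) <= lo j by apply: lo_mono; rewrite /j; lia.
  have H3 : lo j.+1 <= tot by rewrite totE; apply: leq_trans (leq_addr _ _); apply: lo_mono.
  have := bad j (ltnW jl); have -> : minn (lo j) (tot - lo j) = tot - lo j by lia.
  move=> H2; have {H2} : 8 * L * (tot - lo j) < l * cnt j.+1.
    by apply: leq_trans H2 _; rewrite leq_mul2l geq_minr orbT.
  have E : tot - lo j = (tot - lo j.+1) + cnt j.+1 by move: H3; rewrite loS; lia.
  rewrite E !mulnDr !mulnDl; nia.
Qed.

Section Cuts.
Variables (n m : nat) (G : multigraph n m).

(** The unsaturated part of the boundary, controlled by the levels; the saturated part is charged to
    the routed paths. *)
Definition crossing (X : {set 'I_n}) (r : nat -> nat) : {set 'I_m} :=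
  [set e in edges_between G X (~: X) | 0 < r e].

Lemma incident_bound (C : {set 'I_n}) (E : {set 'I_m}) :
  (forall e, e \in E -> ((ends G e).1 \in C) || ((ends G e).2 \in C)) ->
  #|E| <= max_degree G * #|C|.
Proof.
move=> H; pose inc v := [set e : 'I_m | ((ends G e).1 == v) || ((ends G e).2 == v)].
have sub : E \subset \bigcup_(v in C) inc v.
  apply/subsetP => e /H /orP [] Hv; apply/bigcupP.
    by exists (ends G e).1 => //; rewrite inE eqxx.
  by exists (ends G e).2 => //; rewrite inE eqxx orbT.
apply: leq_trans (subset_leq_card sub) _.
apply: (@leq_trans (\sum_(v in C) #|inc v|)).
  elim/big_ind2: _ => [|x1 y1 x2 y2 H1 H2|//]; first by rewrite cards0.
  by apply: leq_trans (leq_card_setU _ _) _; apply: leq_add.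
rewrite mulnC -sum_nat_const; apply: leq_sum => v _.
exact: (@leq_bigmax _ (degree G)).
Qed.

(** An edge that crosses [X :|: S] but not [X] avoids [X] and separates labels at most [j] from
    larger ones. If unsaturated, it joins levels [j] and [j + 1], and can be counted at the smaller
    of the two. [b] selects the upper or the lower side as [S]. *)
Lemma crossing_level (X S : {set 'I_n}) (r d : nat -> nat) (j : nat) (b : bool) :
  (forall e : 'I_m, 0 < r e ->
     d (ends G e).1 <= (d (ends G e).2).+1 /\ d (ends G e).2 <= (d (ends G e).1).+1) ->
  S = [set v : 'I_n | (v \notin X) && ((j < d v) == b)] ->
  #|crossing (X :|: S) r| <= #|crossing X r| +
    max_degree G * minn #|[set v : 'I_n | (v \notin X) && (d v == j)]|
                        #|[set v : 'I_n | (v \notin X) && (d v == j.+1)]|.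
Proof.
move=> Hd ->; set S' := [set v | _]; set C := [set v | _]; set C' := [set v | _].
pose E := [set e : 'I_m | [&& 0 < r e,
   ((ends G e).1 \in C) || ((ends G e).2 \in C)
   & ((ends G e).1 \in C') || ((ends G e).2 \in C')]].
have sub : crossing (X :|: S') r \subset crossing X r :|: E.
  apply/subsetP => e; rewrite !inE => /andP [H re]; have [] := Hd e re.
  move: H; rewrite re /=.
  case: ((ends G e).1 \in X); case: ((ends G e).2 \in X) => //=;
    rewrite ?andbT ?andbF ?orbT ?orbF //=; move: (d _) (d _) => x y; clear; case: b => /=; lia.
apply: leq_trans (subset_leq_card sub) _; apply: leq_trans (leq_card_setU _ _) _.
rewrite leq_add2l; rewrite /minn; case: ifP => _; apply: incident_bound.
all: by move=> e; rewrite inE => /and3P [].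
Qed.

Lemma max_degree_gt0 (e : 'I_m) : 0 < max_degree G.
Proof.
apply: (@leq_trans (degree G (ends G e).1)); last exact: (@leq_bigmax _ (degree G)).
by rewrite card_gt0; apply/set0Pn; exists e; rewrite inE eqxx.
Qed.

Lemma sparse_cut (X : {set 'I_n}) (r : nat -> nat) (l L N N0 : nat) :
  0 < l -> 0 < L -> 32 * (max_degree G * L) <= l ->
  l * #|crossing X r| <= 8 * L * (max_degree G * #|X|) ->
  8 * #|X| <= 5 * n -> (4 * #|X| < n -> N <= #|X|) -> 2 * N <= n -> N0 < 2 * N ->
  m * (l * l %/ L) <= \sum_(e < m) r e + l * (N0 - N) ->
  (forall e, e < m -> r e <= l * l %/ L) ->
  l * #|edges_between G X (~: X)| <= 72 * L * (max_degree G * minn #|X| #|~: X|).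
Proof.
move=> l0 L0 lL HX X5 HN Nn N0N Hr rcap; set D := max_degree G in lL HX *.
(* A boundary edge guarantees degree at least 1, which lets the saturated edges be absorbed into a
   multiple of [D]. *)
case: (set_0Vmem (edges_between G X (~: X))) => [->|[e0 _]].
  by rewrite cards0 muln0.
have D0 : 0 < D := max_degree_gt0 e0.
set cap := l * l %/ L in Hr rcap.
pose sat := [set e : 'I_m | r e == 0].
(* Each saturated edge has used up [cap], while the fewer than [N] paths of the round use at most
   [l] units each. *)
have Hsat : #|sat| * cap <= l * N.
  have : \sum_(e < m) r e <= (m - #|sat|) * cap.
    have -> : m - #|sat| = #|~: sat| by rewrite [RHS]cardsCs setCK card_ord.
    rewrite -sum_nat_const big_mkcond [X in _ <= X]big_mkcond.
    apply: leq_sum => e _; rewrite /sat !inE.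
    by case: eqP => [->|_] //=; apply: rcap.
  have : #|sat| <= m by rewrite -[m in _ <= m]card_ord; apply: max_card.
  move=> H1; rewrite mulnBl => H2.
  have H3 : #|sat| * cap <= m * cap by rewrite leq_mul2r H1 orbT.
  have : l * (N0 - N) <= l * N by rewrite leq_mul2l; lia.
  lia.
(* Rounding [l * l / L] down loses at most half, since [2 * L <= l * l]; here the lower bound on [l]
   enters. *)
have Lc : l * l <= 2 * L * cap.
  have : l * l < cap.+1 * L by apply: ltn_ceil.
  have : 2 * L <= l * l.
    apply: (@leq_trans l); last by rewrite leq_pmull.
    by have : L <= D * L by [rewrite leq_pmull]; lia.
  rewrite mulSn; lia.
have satl : #|sat| * l <= 2 * L * N.
  rewrite -(leq_pmul2r l0); have : #|sat| * (l * l) <= #|sat| * (2 * L * cap).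
    by rewrite leq_mul2l Lc orbT.
  move=> H; rewrite -mulnA; apply: leq_trans H _.
  by rewrite mulnCA -[_ * N * l]mulnA [N * l]mulnC leq_mul2l Hsat orbT.
have N2X : N <= 2 * #|X| by case: (ltnP (4 * #|X|) n) => [/HN|]; lia.
have sub : edges_between G X (~: X) \subset crossing X r :|: sat.
  by apply/subsetP => e H; rewrite !(inE, H) /=; case: (r e); rewrite ?orbT.
have {sub} : #|edges_between G X (~: X)| <= #|crossing X r| + #|sat|.
  by apply: leq_trans (subset_leq_card sub) (leq_card_setU _ _).
rewrite -(leq_pmul2l l0) mulnDr => H; apply: leq_trans H _.
have cX : #|X| + #|~: X| = n by rewrite cardsC card_ord.
have XY : 3 * #|X| <= 5 * minn #|X| #|~: X| by lia.
have H1 : l * #|sat| <= 2 * L * (D * (2 * #|X|)).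
  rewrite mulnC; apply: leq_trans satl _; rewrite leq_mul2l; apply/orP; right.
  by apply: leq_trans N2X _; rewrite leq_pmull.
apply: (@leq_trans (12 * L * (D * #|X|))); first lia.
have H2 : L * D * (3 * #|X|) <= L * D * (5 * minn #|X| #|~: X|).
  by rewrite leq_mul2l XY orbT.
lia.
Qed.

End Cuts.

(** * Arcs and augmenting paths *)

Section Arcs.
Variables (n m : nat) (G : multigraph n m).

Definition end1s : seq nat := [seq val (ends G e).1 | e <- enum 'I_m].
Definition end2s : seq nat := [seq val (ends G e).2 | e <- enum 'I_m].

Definition arc_tl (p : nat) : nat :=
  nth 0 (if odd p then end1s else end2s) (arc_edge p).
Definition arc_hd (p : nat) : nat :=
  nth 0 (if odd p then end2s else end1s) (arc_edge p).

Lemma nth_end1s (e : 'I_m) : nth 0 end1s e = (ends G e).1.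
Proof. by rewrite (nth_map e) ?size_enum_ord // nth_ord_enum. Qed.

Lemma nth_end2s (e : 'I_m) : nth 0 end2s e = (ends G e).2.
Proof. by rewrite (nth_map e) ?size_enum_ord // nth_ord_enum. Qed.

Lemma arc_cases p : is_arc m p -> exists2 e : 'I_m, arc_edge p = e &
  (arc_tl p = (ends G e).1 /\ arc_hd p = (ends G e).2) \/
  (arc_tl p = (ends G e).2 /\ arc_hd p = (ends G e).1).
Proof.
move=> Hp; have lt : arc_edge p < m by move: Hp; rewrite /is_arc /arc_edge; lia.
pose e := Ordinal lt; exists e => //; rewrite /arc_tl /arc_hd -[arc_edge p]/(val e).
by rewrite !(fun_if (fun x => nth 0 x _)) nth_end1s nth_end2s; case: odd; [left|right].
Qed.

Lemma edge_arcs (e : 'I_m) : exists p q,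
  [/\ is_arc m p, arc_edge p = e, arc_tl p = (ends G e).1 & arc_hd p = (ends G e).2] /\
  [/\ is_arc m q, arc_edge q = e, arc_tl q = (ends G e).2 & arc_hd q = (ends G e).1].
Proof.
have E1 : arc_edge (2 * e).+1 = e by rewrite /arc_edge; lia.
have E2 : arc_edge (2 * e).+2 = e by rewrite /arc_edge; lia.
exists (2 * e).+1, (2 * e).+2; have := ltn_ord e.
rewrite /arc_tl /arc_hd E1 E2 /= oddM /= nth_end1s nth_end2s /is_arc => lt.
by split; split=> //; lia.
Qed.

Lemma arc_tl_lt p : is_arc m p -> arc_tl p < n.
Proof. by move=> /arc_cases [e _ [] [-> _]]. Qed.

Lemma arc_tl_hd p : is_arc m p -> arc_tl p <> arc_hd p.
Proof.
by move=> /arc_cases [e _ [] [-> ->]] /val_inj /eqP;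
  [|rewrite eq_sym]; apply/negP; apply: loopless.
Qed.

Lemma arc_joins p (u : 'I_n) : is_arc m p -> arc_tl p = u ->
  exists (e : 'I_m) (v : 'I_n), [/\ arc_edge p = e, arc_hd p = v & joins G e u v].
Proof.
move=> /arc_cases [e -> [] [-> ->]] /val_inj <-.
  by exists e, (ends G e).2; rewrite /joins -surjective_pairing eqxx.
exists e, (ends G e).1; split=> //; apply/orP; right; exact/eqP/surjective_pairing.
Qed.

(** Labels dropping by exactly one make the search path simple and bound its length by the label of
    its source. *)
Definition descends (d : nat -> nat) : rel 'I_n := fun x y => d x == (d y).+1.

Lemma descends_size d a vs : path (descends d) a vs -> d a = d (last a vs) + size vs.
Proof.
elim: vs a => [|v vs IH] a /=; first by rewrite addn0.
by move=> /andP [/eqP -> /IH ->]; rewrite addnS.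
Qed.

Lemma descends_uniq d a vs : path (descends d) a vs -> uniq (a :: vs).
Proof.
move=> H; apply: (@sorted_uniq _ (fun x y : 'I_n => d y < d x)).
- by move=> x y z' H1 H2; apply: ltn_trans H2 H1.
- by move=> x; rewrite ltnn.
- by move: H => /=; apply: sub_path => x y /eqP ->.
Qed.

Lemma descends_upd d a vs (v : 'I_n) x :
  path (descends d) a vs -> v \notin a :: vs -> path (descends (upd d v x)) a vs.
Proof.
elim: vs a => //= b vs IH a /andP [H1 H2]; rewrite !inE !negb_or => /and3P [N1 N2 N3].
rewrite IH ?inE ?negb_or ?N2 // andbT /descends !upd_neq //.
  by rewrite eq_sym; apply: contraNneq N2 => /val_inj ->.
by rewrite eq_sym; apply: contraNneq N1 => /val_inj ->.
Qed.

Lemma is_walk_rcons u p e v : is_walk G u (rcons p (e, v)) =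
  is_walk G u p && joins G e (last u (unzip2 p)) v.
Proof.
elim: p u => [|[e' w] p IH] u /=; first by rewrite andbT.
by rewrite IH andbA.
Qed.

Definition is_stack (r d : nat -> nat) (a : 'I_n) (stk : seq ('I_m * 'I_n)) : Prop :=
  [/\ is_walk G a stk, path (descends d) a (unzip2 stk)
    & all (fun x : 'I_m * 'I_n => 0 < r x.1) stk].

Lemma is_stack_push r d a stk e v :
  is_stack r d a stk -> joins G e (last a (unzip2 stk)) v -> 0 < r e ->
  d (last a (unzip2 stk)) = (d v).+1 -> is_stack r d a (rcons stk (e, v)).
Proof.
move=> [H1 H2 H3] H4 H5 H6; split; first by rewrite is_walk_rcons H1.
- by rewrite /unzip2 map_rcons rcons_path H2 /=; apply/eqP.
- by rewrite all_rcons /= H5.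
Qed.

Lemma is_stack_pop r d a stk x y :
  is_stack r d a (rcons stk x) -> is_stack r (upd d x.2 y) a stk.
Proof.
case: x => e v [H1 H2 H3]; split.
- by move: H1; rewrite is_walk_rcons => /andP [].
- apply: descends_upd.
    by move: H2; rewrite /unzip2 map_rcons rcons_path => /andP [].
  have := descends_uniq H2; rewrite /unzip2 map_rcons -rcons_cons rcons_uniq.
  by case/andP.
- by move: H3; rewrite all_rcons => /andP [].
Qed.

(** A relabelled top is popped, since the step into it no longer descends by one. If the top is the
    source itself, the stack is empty and stays so: [size stk - 1] is truncated at 0. *)
Lemma is_stack_relabel r d a stk y : is_stack r d a stk ->
  exists stk' rest, [/\ stk = stk' ++ rest, size stk' = size stk - 1
    & is_stack r (upd d (last a (unzip2 stk)) y) a stk'].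
Proof.
case/lastP: stk => [_|stk x H]; first by exists [::], [::].
exists stk, [:: x]; rewrite cats1 size_rcons subn1; split=> //.
by rewrite /unzip2 map_rcons last_rcons; apply: is_stack_pop H.
Qed.

End Arcs.

(** * The search from one source *)

(** The tentative path is written directly behind the recorded ones in the output arrays 3 and 4:
    success needs no copying, and failure leaves garbage only beyond the recorded prefix. *)
Definition dfs_step : cmd :=
  Assign 15 (Read 14 (Reg 13)) ;;
  Assign 16 (Read 13 (Reg 15)) ;;
  If (Bin Eq (Read 9 (Reg 15)) (Reg 10)) (Assign 14 (Num 1))
  (If (Bin Eq (Reg 16) (Num 0))
    (Store 12 (Reg 15) (Bin Add (Read 12 (Reg 15)) (Num 1)) ;;
     Store 13 (Reg 15) (Read 7 (Reg 15)) ;;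
     Assign 13 (Bin Sub (Reg 13) (Num 1)))
    (Assign 17 (Read 5 (Reg 16)) ;;
     Assign 18 (Bin Div (Bin Sub (Reg 16) (Num 1)) (Num 2)) ;;
     If (Bin Mul (Bin Lt (Num 0) (Read 10 (Reg 18)))
                 (Bin Eq (Read 12 (Reg 15)) (Bin Add (Read 12 (Reg 17)) (Num 1))))
       (Store 3 (Bin Add (Reg 20) (Reg 13)) (Reg 18) ;;
        Store 4 (Bin Add (Reg 20) (Reg 13)) (Reg 17) ;;
        Assign 13 (Bin Add (Reg 13) (Num 1)) ;;
        Store 14 (Reg 13) (Reg 17))
       (Store 13 (Reg 15) (Read 6 (Reg 16))))).

Definition dfs_guard : expr :=
  Bin Mul (Bin Eq (Reg 14) (Num 0))
          (Bin Lt (Read 12 (Reg 12)) (Bin Add (Reg 3) (Num 1))).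

Definition dfs_init : cmd :=
  Assign 13 (Num 0) ;; Store 14 (Num 0) (Reg 12) ;; Assign 14 (Num 0).

(** Covers all intermediate values, which are at most a small constant times a product of two
    quantities linear in the input parameters. *)
Definition big_word (n m k l z w : nat) : Prop :=
  20 * (n + m + k + l + z + 10) ^ 2 < 2 ^ w.

Section Search.
Variables (n m k : nat) (G : multigraph n m) (A B : 'I_k -> {set 'I_n}).
Variables (z l w : nat).
Hypothesis word : big_word n m k l z w.

Lemma word_linear x : x <= 20 * (n + m + k + l + z + 10) -> x < 2 ^ w.
Proof.
move=> H; apply: leq_ltn_trans H _; apply: leq_ltn_trans word.
by rewrite -mulnn mulnA leq_pmulr //; lia.
Qed.

Lemma word_mul c x y : c <= 20 -> x <= n + m + k + l + z + 10 ->
  y <= n + m + k + l + z + 10 -> c * (x * y) < 2 ^ w.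
Proof. by move=> Hc Hx Hy; apply: leq_ltn_trans word; rewrite -mulnn !leq_mul. Qed.

Lemma word_mul1 x y : x <= n + m + k + l + z + 10 ->
  y <= n + m + k + l + z + 10 -> x * y < 2 ^ w.
Proof. by rewrite -[x * y]mul1n; apply: word_mul. Qed.

Definition log : nat := trunc_log 2 n.
Definition cap : nat := l * l %/ log.

Definition statics (s : state) : Prop :=
  [/\ [/\ reg s 0 = n, reg s 1 = m, reg s 2 = k, reg s 3 = l & reg s 4 = z],
      reg s 5 = log, reg s 6 = cap,
      adj_lists n (2 * m) (arc_tl G) (mem s 7) (mem s 6)
    & forall p, is_arc m p -> mem s 5 p = arc_hd G p].

Lemma statics_same c s s' : same c s s' ->
  all (fun x => 6 < x) (wregs c) -> all (fun a => (a < 5) || (7 < a)) (wmems c) ->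
  statics s -> statics s'.
Proof.
move=> [R M] HR HM [[E0 E1 E2 E3 E4] E5 E6 H1 H2].
have R' x : x < 7 -> reg s' x = reg s x.
  move=> Hx; apply: R; apply/negP => /(allP HR); lia.
have M' x : 4 < x < 8 -> mem s' x = mem s x.
  move=> Hx; apply: M; apply/negP => /(allP HM); lia.
by split; rewrite ?R' ?M' //; split; rewrite ?R'.
Qed.

(** [pre] is the concatenation of the paths already recorded and [d0] the labelling before the
    search. Success implies [d a <= l], so a path that is found has length at most [l]. *)
Definition dfs_inv (i : nat) (a : 'I_n) (pre stk : seq ('I_m * 'I_n))
    (d0 : nat -> nat) (s : state) : Prop :=
  [/\ labelling n m l (arc_tl G) (arc_hd G) i (mem s 10) (mem s 12) (mem s 13) (mem s 9),
      is_stack G (mem s 10) (mem s 12) a stk,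
      holds (mem s 14) [seq val v | v <- a :: unzip2 stk],
      holds (mem s 3) [seq val x.1 | x <- pre ++ stk] /\
      holds (mem s 4) [seq val x.2 | x <- pre ++ stk]
    & [/\ reg s 13 = size stk, reg s 14 <= 1,
          reg s 14 = 1 -> mem s 9 (last a (unzip2 stk)) = i,
          reg s 14 = 1 -> mem s 12 a <= l
        & forall v, v < n -> d0 v <= mem s 12 v]].

(** A push lowers the second term. A pop raises it by one but comes with a relabelling, so the label
    potential is counted twice. The factor 13 covers the time of one iteration. *)
Definition dfs_potential (s : state) : nat :=
  13 * (2 * potential n m l (arc_tl G) (mem s 12) (mem s 13)
        + (l.+1 - reg s 13) + (1 - reg s 14)).

Lemma holds_last (f : nat -> nat) (a : 'I_n) (vs : seq 'I_n) :
  holds f [seq val v | v <- a :: vs] -> f (size vs) = last a vs.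
Proof.
move=> H; rewrite H ?size_map //= -(last_map val) (last_nth 0) size_map //.
Qed.

Lemma dfs_step_spec i (a : 'I_n) pre stk d0 s :
  statics s -> reg s 10 = i -> reg s 12 = a -> reg s 20 = size pre ->
  size pre <= n * l ->
  dfs_inv i a pre stk d0 s -> reg s 14 = 0 -> mem s 12 a <= l ->
  spec w dfs_step s (fun t s' =>
    (exists stk', dfs_inv i a pre stk' d0 s') /\
    t.+1 + dfs_potential s' <= dfs_potential s).
Proof.
move=> [[E0 E1 E2 E3 E4] E5 E6 Hadj Hhd] E10 E12 E20 Hpre.
move=> [Hlab Hstk H14 [Hm3 Hm4] [E13 _ _ _ Hd0]] F0 da.
have [HV HB HC HP HD] := Hlab; have [W1 W2 W3] := Hstk.
pose cur := last a (unzip2 stk).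
have q_le : size stk + mem s 12 cur = mem s 12 a.
  by rewrite (descends_size W2) size_map addnC.
have Ecur : mem s 14 (reg s 13) = cur.
  by rewrite E13 -(size_map snd stk); apply: holds_last.
have cn : cur < n := ltn_ord cur.
have dcur : mem s 12 cur <= l by lia.
have [ptr_le ptr_tl] := HP _ cn.
have fit20 : size pre + size stk < 2 ^ w.
  have H1 : l * n.+1 < 2 ^ w by apply: word_mul1; lia.
  apply: leq_ltn_trans H1; rewrite mulnS mulnC; lia.
have w1 : 1 < 2 ^ w by apply: word_linear; lia.
have w0 : 0 < 2 ^ w by apply: ltnW.
rewrite /dfs_step.
apply: spec_seq_assign => //; apply: spec_seq_assign => //.
set s1 := set_reg _ 15 _.
rewrite /= Ecur in s1 *; set s2 := set_reg _ 16 _.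
apply: spec_if => //=; rewrite E10 ?Ecur.
  move=> /nat_bool_neq0 /eqP Ei; apply: spec_assign => //; split.
    by exists stk; split.
  by rewrite /dfs_potential /= F0; lia.
move=> /nat_bool_eq0 /eqP Ni; apply: spec_if => //=.
  move=> /nat_bool_neq0 /eqP p0.
  apply: spec_seq_store => //=.
    by split=> //; apply: word_linear; lia.
  apply: spec_seq_store => //; apply: spec_assign.
    by split=> //=; rewrite E13; lia.
  split; last first.
    have := potential_relabel m (arc_tl G) (mem s 7) cn p0 dcur.
    rewrite /dfs_potential /= F0 E13 addn1.
    rewrite /upd; lia.
  have lab' := labelling_relabel (@arc_tl_hd _ _ G) Hadj Hlab cn p0 Ni dcur.
  have [stk' [rest [Es size_stk' Hstk']]] := is_stack_relabel (mem s 12 cur).+1 Hstk.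
  exists stk'; split=> //=.
  - by move: lab'; rewrite /= addn1.
  - by move: Hstk'; rewrite /= addn1.
  - by move: H14; rewrite Es /unzip2 map_cat -cat_cons map_cat => /holds_cat.
  - by move: Hm3 Hm4; rewrite Es catA !map_cat => /holds_cat ? /holds_cat ?.
  - rewrite E13 F0; split=> // v vn; rewrite addn1 /upd /=.
    by have := Hd0 v vn; case: eqP => [->|_]; lia.
move=> /nat_bool_eq0 /eqP p0.
apply: spec_seq_assign => //; apply: spec_seq_assign.
  by fits_split; apply: word_linear; lia.
set s3 := set_reg _ 17 _; set s4 := set_reg _ 18 _.
have ptr_arc : is_arc m (mem s 13 cur) by rewrite /is_arc ptr_le andbT; lia.
have [e [v [Ee Ev J]]] := arc_joins ptr_arc (ptr_tl ltac:(lia)).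
have E17 : mem s 5 (mem s 13 cur) = v by rewrite Hhd.
have vn := ltn_ord v.
apply: spec_if.
  fits_split=> //; try by apply: word_linear; have := HD _ vn; rewrite Hhd //= Ev; lia.
- rewrite /= -/(arc_edge _) Ee E17 [_ + 1]addn1 nat_bool_muln.
  move=> /nat_bool_neq0 /andP [re /eqP dE].
  apply: spec_seq_store => //=; first by rewrite E20 E13.
  apply: spec_seq_store => //=; first by rewrite E20 E13.
  apply: spec_seq_assign => //=.
    by split=> //; rewrite E13; apply: word_linear; lia.
  apply: spec_store => //=.
  split; last first.
    rewrite /dfs_potential -[X in 2 * X]/(potential n m l (arc_tl G) (mem s 12) (mem s 13)).
    by rewrite /= F0 E13; lia.
  exists (rcons stk (e, v)); split=> //=.
  + exact: is_stack_push.
  + rewrite /unzip2 !map_rcons -rcons_cons E13 E17 addn1.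
    have := holds_rcons (v := val v) H14; rewrite size_map /= size_map; exact.
  + rewrite E20 E13 E17 -/(arc_edge _) Ee -rcons_cat !map_rcons -size_cat.
    by split; [have := holds_rcons (v := val e) Hm3 | have := holds_rcons (v := val v) Hm4];
       rewrite size_map.
  + by rewrite size_rcons E13 addn1 F0.
- rewrite /= -/(arc_edge _) Ee E17 [_ + 1]addn1 nat_bool_muln => /nat_bool_eq0 H.
  have pos : 0 < mem s 13 cur by lia.
  have na : ~~ ((0 < mem s 10 (arc_edge (mem s 13 cur))) &&
                (mem s 12 cur == (mem s 12 (arc_hd G (mem s 13 cur))).+1)).
    by rewrite Ee Ev.
  apply: spec_store => //; split; last first.
    have := potential_advance l Hadj (mem s 12) cn ptr_arc (ptr_tl pos).
    rewrite /dfs_potential -[X in 2 * X](_ : potential n m l (arc_tl G) (mem s 12)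
      (upd (mem s 13) cur (mem s 6 (mem s 13 cur))) = _) //.
    by rewrite /= F0; lia.
  exists stk; split=> //=; last by rewrite F0.
  exact (labelling_advance Hadj Hlab cn pos na).
Qed.

Definition search : cmd := dfs_init ;; While dfs_guard dfs_step.

(** With the label potential on both sides of the time bound, the label work telescopes over the
    sources of one pair of sets, and each source adds only O(l). *)
Lemma search_spec i (a : 'I_n) pre s :
  statics s -> reg s 10 = i -> reg s 12 = a -> reg s 20 = size pre ->
  size pre <= n * l ->
  labelling n m l (arc_tl G) (arc_hd G) i (mem s 10) (mem s 12) (mem s 13) (mem s 9) ->
  holds (mem s 3) [seq val x.1 | x <- pre] ->
  holds (mem s 4) [seq val x.2 | x <- pre] ->
  spec w search s (fun t s' =>
    [/\ exists stk, dfs_inv i a pre stk (mem s 12) s',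
        reg s' 14 = 0 -> mem s' 12 a = l.+1
      & t + 26 * potential n m l (arc_tl G) (mem s' 12) (mem s' 13) <=
        26 * potential n m l (arc_tl G) (mem s 12) (mem s 13) + 13 * l + 40]).
Proof.
move=> Hst E10 E12 E20 Hpre Hlab H3 H4; rewrite /search /dfs_init.
have w1 : 1 < 2 ^ w by apply: word_linear; lia.
have w0 : 0 < 2 ^ w by apply: ltnW.
apply: spec_seq.
apply: spec_seq_assign => //; apply: spec_seq_store => //; apply: spec_assign => //.
set s1 := set_reg _ _ _.
pose I s' := exists stk, dfs_inv i a pre stk (mem s 12) s'.
have st s' : same (While dfs_guard dfs_step) s1 s' ->
  [/\ statics s', reg s' 10 = i, reg s' 12 = a & reg s' 20 = size pre].
  move=> S; split; last 3 first; try by rewrite S.1.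
  exact: statics_same S _ _ Hst.
have I1 : I s1.
  exists [::]; split=> //=; last by rewrite cats0.
  by case=> //= _; rewrite E12.
apply: spec_conseq (@spec_while w _ _ s1 I dfs_potential I1 _ _) _.
- move=> s' /st [Hst' _ _ _] [stk [Hlab' _ _ _ _]]; fits_split=> //.
    by case: Hst' => [[_ _ _ -> _]] *; apply: word_linear; lia.
  by apply: word_linear; lia.
- move=> s' /st [Hst' E10' E12' E20'] [stk Hinv].
  have [[_ _ _ E3' _] _ _ _ _] := Hst'.
  rewrite /= nat_bool_muln => /nat_bool_neq0 /andP [/eqP F0].
  rewrite E12' E3' addn1 ltnS => da.
  exact: dfs_step_spec Hst' E10' E12' E20' Hpre Hinv F0 da.
- move=> t s' [/st [Hst' E10' E12' E20'] Is' /= + Ht].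
  have [[_ _ _ E3' _] _ _ _ _] := Hst'.
  rewrite nat_bool_muln E12' E3' addn1 => /nat_bool_eq0 Hg.
  split=> //.
    move=> F0; case: Is' => stk [[_ _ _ _ HD] _ _ _ _].
    by have := HD _ (ltn_ord a); move: Hg; rewrite F0 /=; lia.
  move: Ht; rewrite /dfs_potential.
  rewrite -[X in 2 * X + (_ - reg s1 _)]
    (_ : potential n m l (arc_tl G) (mem s 12) (mem s 13) = _) //=.
  lia.
Qed.

End Search.

(** * Recording a path *)

Definition dec_loop : cmd :=
  While (Bin Lt (Reg 20) (Reg 24))
    (Store 10 (Read 3 (Reg 20)) (Bin Sub (Read 10 (Read 3 (Reg 20))) (Num 1)) ;;
     Assign 20 (Bin Add (Reg 20) (Num 1))).

Definition record : cmd :=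
  Assign 15 (Read 14 (Reg 13)) ;;
  Store 0 (Reg 19) (Reg 12) ;;
  Store 1 (Reg 19) (Reg 15) ;;
  Store 2 (Reg 19) (Reg 13) ;;
  Assign 19 (Bin Add (Reg 19) (Num 1)) ;;
  Store 8 (Reg 12) (Num 0) ;;
  Store 9 (Reg 15) (Num 0) ;;
  Assign 7 (Bin Sub (Reg 7) (Num 1)) ;;
  Assign 24 (Bin Add (Reg 20) (Reg 13)) ;;
  dec_loop.

Definition source : cmd := search ;; If (Reg 14) record Skip.

Lemma sum_upd_pred m (r : nat -> nat) (e0 : nat) :
  \sum_(e < m) r e <= \sum_(e < m) upd r e0 (r e0 - 1) e + 1.
Proof.
case: (ltnP e0 m) => H.
  rewrite (bigD1 (Ordinal H)) //= [X in _ <= X + 1](bigD1 (Ordinal H)) //= upd_eq.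
  rewrite [X in _ <= _ + X + 1](eq_bigr (fun i : 'I_m => r i)); first by lia.
  by move=> i Hi; rewrite upd_neq //; apply: contraNneq Hi => Ei; apply/eqP/val_inj.
rewrite [X in _ <= X + 1](eq_bigr (fun i : 'I_m => r i)) ?leq_addr // => i _.
by rewrite upd_neq // neq_ltn (leq_trans (ltn_ord i) H).
Qed.

Lemma card_bigcup_disjoint (T : finType) k (F : 'I_k -> {set T}) :
  (forall i j, i != j -> [disjoint F i & F j]) ->
  #|\bigcup_i F i| = \sum_(i < k) #|F i|.
Proof.
move=> D; rewrite (eq_bigr (fun i => \sum_(v in F i) 1)); last by move=> i _; rewrite sum1_card.
by rewrite -sum1_card partition_disjoint_bigcup.
Qed.

Section Record.
Variables (n m k : nat) (G : multigraph n m) (A B : 'I_k -> {set 'I_n}).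
Variables (z l w : nat).
Hypothesis word : big_word n m k l z w.
Hypothesis disj : disjoint_family A B.
Hypothesis AB : forall i, #|A i| <= #|B i|.

Definition total : nat := \sum_(i < k) #|A i|.

(** This makes the logarithm of the number of sources smaller than [log n], hence bounds the number
    of halving rounds, and it gives [N <= n / 2] for the comparison with the cut. *)
Lemma double_total : 2 * total <= n.
Proof.
have [D1 D2 D3] := disj.
rewrite mul2n -addnn; apply: (@leq_trans (#|\bigcup_i A i| + #|\bigcup_i B i|)).
  by rewrite !card_bigcup_disjoint // leq_add2l; apply: leq_sum => i _.
rewrite -cardsUI; have -> : (\bigcup_i A i) :&: (\bigcup_i B i) = set0.
  apply/setP => v; rewrite !inE; apply/negP => /andP [/bigcupP [i _ H1] /bigcupP [j _ H2]].
  by have := disjointFr (D1 i j) H1; rewrite H2.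
by rewrite cards0 addn0 -[X in _ <= X]card_ord max_card.
Qed.

Definition cls (f : nat -> nat) (i : nat) : nat := #|[set v : 'I_n | f v == i.+1]|.

Lemma cls_clear f (v : 'I_n) i : cls (upd f v 0) i + (f v == i.+1) = cls f i.
Proof.
rewrite /cls [RHS](cardsD1 v) inE addnC; congr (_ + _).
apply: eq_card => u; rewrite !inE /upd.
by rewrite -val_eqE /=; case: (nat_of_ord u == v).
Qed.

(** * Invariants of the recorded routing *)

Definition route : Type := ('I_n * 'I_n) * seq ('I_m * 'I_n).

Definition valid_routes (rt : seq route) : Prop :=
  [/\ forall x, x \in rt -> [/\ is_path G x.1.1 x.1.2 x.2, size x.2 <= l
        & exists i, x.1.1 \in A i /\ x.1.2 \in B i],
      uniq [seq x.1.1 | x : route <- rt]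
    & uniq [seq x.1.2 | x : route <- rt]].

Definition stored (rt : seq route) (s : state) : Prop :=
  [/\ reg s 19 = size rt,
      reg s 20 = size (flatten (unzip2 rt)),
      holds (mem s 0) [seq val x.1.1 | x : route <- rt] /\
      holds (mem s 1) [seq val x.1.2 | x : route <- rt],
      holds (mem s 2) [seq size x.2 | x : route <- rt]
    & holds (mem s 3) [seq val x.1 | x <- flatten (unzip2 rt)] /\
      holds (mem s 4) [seq val x.2 | x <- flatten (unzip2 rt)]].

(** [base] bounds the capacity granted to an edge over all rounds so far; each path pays one unit on
    each of its edges, so [base] bounds the congestion. In every pair of sets the free targets
    remain at least as many as the unrouted sources. *)
Definition routing_inv (base : nat) (rt : seq route) (s : state) : Prop :=
  [/\ valid_routes rt, stored rt s,
      forall (v : 'I_n) (i : 'I_k),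
        (mem s 8 v = i.+1 -> v \in A i /\ v \notin [seq x.1.1 | x : route <- rt]) /\
        (mem s 9 v = i.+1 -> v \in B i /\ v \notin [seq x.1.2 | x : route <- rt]),
      [/\ forall i, i < k -> cls (mem s 8) i <= cls (mem s 9) i,
          reg s 7 = \sum_(i < k) cls (mem s 8) i & reg s 7 + size rt = total]
    & forall e : 'I_m, mem s 10 e <= cap n l /\
        count (fun x : route => e \in unzip1 x.2) rt + mem s 10 e <= base].

(** Progress within one round. By the last clause, written without subtraction, a newly routed
    source costs at most [l] units of the total capacity. *)
Definition evolves (s s' : state) : Prop :=
  [/\ forall e, e < m -> mem s' 10 e <= mem s 10 e,
      forall v, v < n -> mem s' 8 v = mem s 8 v \/ mem s' 8 v = 0,
      forall v, v < n -> mem s' 9 v = mem s 9 v \/ mem s' 9 v = 0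
    & \sum_(e < m) mem s 10 e + l * reg s' 7 <= \sum_(e < m) mem s' 10 e + l * reg s 7].

Lemma evolves_refl s : evolves s s.
Proof. by split=> // *; left. Qed.

Lemma evolves_trans s1 s2 s3 : evolves s1 s2 -> evolves s2 s3 -> evolves s1 s3.
Proof.
move=> [R1 A1 B1 S1] [R2 A2 B2 S2]; split; last lia.
- by move=> e He; apply: leq_trans (R2 _ He) (R1 _ He).
- by move=> v Hv; case: (A2 _ Hv) => ->; [apply: A1 | right].
- by move=> v Hv; case: (B2 _ Hv) => ->; [apply: B1 | right].
Qed.

Lemma size_routes base rt s : routing_inv base rt s ->
  size rt <= n /\ size (flatten (unzip2 rt)) <= n * l.
Proof.
move=> [[H1 H2 H3] _ _ [_ _ H4] _].
have Hn : size rt <= n by have := double_total; lia.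
split=> //; apply: (@leq_trans (size rt * l)); last by rewrite leq_mul2r Hn orbT.
have : forall x, x \in rt -> size x.2 <= l by move=> x /H1 [].
elim: rt {H1 H2 H3 H4 Hn} => //= x rt IH H; rewrite size_cat mulSn leq_add //.
  by apply: H; rewrite inE eqxx.
by apply: IH => y Hy; apply: H; rewrite inE Hy orbT.
Qed.

(** Two one-sided bounds avoid any discussion of repeated edges: each edge of the path loses at
    least one unit, for the congestion, and the total loses at most the length, for the number of
    saturated edges. *)
Lemma dec_loop_spec (pre stk : seq ('I_m * 'I_n)) s :
  reg s 20 = size pre -> reg s 24 = size pre + size stk ->
  size pre + size stk < 2 ^ w ->
  holds (mem s 3) [seq val x.1 | x <- pre ++ stk] ->
  (forall e : 'I_m, mem s 10 e < 2 ^ w) ->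
  spec w dec_loop s (fun t s' =>
    [/\ reg s' 20 = size (pre ++ stk),
        forall e, e < m -> mem s' 10 e <= mem s 10 e,
        forall x : 'I_m * 'I_n, x \in stk -> 0 < mem s 10 x.1 -> mem s' 10 x.1 < mem s 10 x.1,
        \sum_(e < m) mem s 10 e <= \sum_(e < m) mem s' 10 e + size stk
      & t <= 3 * size stk + 1]).
Proof.
move=> E20 E24 Hw H3 Hr.
pose I j s' := [/\ forall e, e < m -> mem s' 10 e <= mem s 10 e,
  forall x : 'I_m * 'I_n, x \in take (j - size pre) stk ->
    0 < mem s 10 x.1 -> mem s' 10 x.1 < mem s 10 x.1
  & \sum_(e < m) mem s 10 e <= \sum_(e < m) mem s' 10 e + (j - size pre)].
have w1 : 1 < 2 ^ w by apply: word_linear word _ _; lia.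
apply: spec_conseq (@spec_for w 20 _ _ s (size pre) (size pre + size stk) 2 I (fun=> 0)
  _ _ E20 w1 _ _) _.
- by rewrite /I subnn take0; split=> //; rewrite addn0.
- exact: leq_addr.
- by move=> s' S; split=> //=; rewrite S.1.
- move=> s' j S [I1 I2 I3] pj jq E20'.
  have js : j - size pre < size stk by lia.
  have x0 : 'I_m * 'I_n by case: (stk) js.
  pose x := nth x0 stk (j - size pre).
  have E3 : mem s' 3 j = x.1.
    rewrite (S.2 3) // H3 ?size_map ?size_cat // (nth_map x0) ?size_cat //.
    by rewrite nth_cat ltnNge pj.
  apply: spec_seq_store => //=; rewrite E20' E3.
    by fits_split=> //; apply: leq_ltn_trans (Hr x.1); have := I1 _ (ltn_ord x.1); lia.
  apply: spec_assign => //=; first by fits_split=> //; rewrite E20'; lia.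
  rewrite E20' addn1; split=> //; rewrite /I subSn //; split.
  + move=> e He /=; apply: leq_trans (I1 _ He).
    by case: eqP => [->|//]; lia.
  + move=> y; rewrite (take_nth x0) // mem_rcons inE -/x => Hy y0.
    have := I1 _ (ltn_ord y.1); case/orP: Hy => [/eqP Ey|Hy] /=.
      by rewrite Ey eqxx /= => Hle; move: y0; rewrite Ey; lia.
    by have := I2 _ Hy y0; case: eqP => [->|//]; lia.
  + apply: (leq_trans I3); rewrite -addSnnS leq_add2r -[X in _ <= X]addn1.
    exact (sum_upd_pred m (mem s' 10) x.1).
- move=> t s' [S [I1 I2 I3] E' Ht]; split=> //.
  + by rewrite E' size_cat.
  + by move=> x Hx; apply: I2; rewrite addKn take_size.
  + by rewrite addKn in I3.
  + by move: Ht; rewrite addKn; lia.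
Qed.

Lemma valid_routes_rcons rt (a v : 'I_n) stk i :
  valid_routes rt -> is_path G a v stk -> size stk <= l -> a \in A i -> v \in B i ->
  a \notin [seq x.1.1 | x : route <- rt] -> v \notin [seq x.1.2 | x : route <- rt] ->
  valid_routes (rcons rt ((a, v), stk)).
Proof.
move=> [H1 H2 H3] Hp Hs Ha Hv Na Nv; split.
- move=> x; rewrite mem_rcons inE => /orP [/eqP ->|/H1 //].
  by split=> //; exists i.
- by rewrite map_rcons rcons_uniq Na.
- by rewrite map_rcons rcons_uniq Nv.
Qed.

Lemma cls_route (la lb : nat -> nat) (a v : 'I_n) (gi : 'I_k) :
  la a = gi.+1 -> lb v = gi.+1 ->
  (forall i, i < k -> cls la i <= cls lb i) ->
  (forall i, i < k -> cls (upd la a 0) i <= cls (upd lb v 0) i) /\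
  \sum_(i < k) cls la i = \sum_(i < k) cls (upd la a 0) i + 1.
Proof.
move=> Ea Ev H; split=> [i /H|].
  have := cls_clear la a i; have := cls_clear lb v i; rewrite Ea Ev; lia.
rewrite (bigD1 gi) //= [X in _ = X + 1](bigD1 gi) //=.
have := cls_clear la a gi; rewrite Ea eqxx => <-; rewrite addnAC; congr (_ + _ + _).
apply: eq_bigr => i Hi; have := cls_clear la a i; rewrite Ea eqSS.
by case: eqP => [E|_]; [case/eqP: Hi; apply/val_inj | rewrite addn0].
Qed.

Lemma record_spec base rt (gi : 'I_k) (a : 'I_n) stk s :
  routing_inv base rt s -> reg s 12 = a -> mem s 8 a = gi.+1 ->
  reg s 13 = size stk -> is_stack G (mem s 10) (mem s 12) a stk ->
  holds (mem s 14) [seq val v | v <- a :: unzip2 stk] ->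
  holds (mem s 3) [seq val x.1 | x <- flatten (unzip2 rt) ++ stk] ->
  holds (mem s 4) [seq val x.2 | x <- flatten (unzip2 rt) ++ stk] ->
  mem s 9 (last a (unzip2 stk)) = gi.+1 -> size stk <= l ->
  spec w record s (fun t s' =>
    [/\ routing_inv base (rcons rt ((a, last a (unzip2 stk)), stk)) s',
        evolves s s', mem s' 8 a = 0 & t <= 3 * l + 10]).
Proof.
set v := last a _.
move=> RI E12 Ea E13 Hstk H14 H3 H4 Ev Hl.
have [rtn offn] := size_routes RI; have [VR [E19 E20 [S0 S1] S2 _] HA [C1 C2 C3] Hr] := RI.
have Ecur : mem s 14 (reg s 13) = v by rewrite E13 -(size_map snd stk); apply: holds_last.
have lin := word_linear word; have w1 : 1 < 2 ^ w by apply: lin; lia.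
have w0 : 0 < 2 ^ w by apply: ltnW.
have fit20 : size (flatten (unzip2 rt)) + size stk < 2 ^ w.
  have H1 : l * n.+1 < 2 ^ w.
    by apply: (word_mul1 word); lia.
  apply: leq_ltn_trans H1; rewrite mulnS mulnC; lia.
have capw : cap n l < 2 ^ w.
  apply: leq_ltn_trans (leq_div _ _) _.
  by apply: (word_mul1 word); lia.
have Nn : reg s 7 <= n by have := double_total; lia.
rewrite /record; apply: spec_seq_assign => //; rewrite /= Ecur; set s1 := set_reg _ _ _.
do 3 apply: spec_seq_store => //=.
apply: spec_seq_assign; first by fits_split=> //; rewrite E19; apply: lin; lia.
do 2 apply: spec_seq_store => //=.
apply: spec_seq_assign; first by fits_split=> //; apply: lin; lia.
apply: spec_seq_assign; first by fits_split=> //; rewrite E20 E13.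
set s2 := set_reg _ 24 _.
have E3' : mem s2 3 = mem s 3 by [].
have E10' : mem s2 10 = mem s 10 by [].
apply: spec_conseq (spec_same (@dec_loop_spec (flatten (unzip2 rt)) stk s2 _ _ _ _ _)) _ => //.
- by rewrite /s2 /= E20 E13.
- by move=> e; apply: leq_ltn_trans (Hr e).1 capw.
move=> t s' [[R M] [E20' D1 D2 D3 Ht]].
have [Hcls1 Hcls2] := cls_route Ea Ev C1.
have E7' : reg s' 7 = reg s 7 - 1 by rewrite R.
have E8 : mem s' 8 = upd (mem s 8) a 0 by rewrite M // /s2 /= E12.
have E9 : mem s' 9 = upd (mem s 9) v 0 by rewrite M.
split; last first.
- by move: Ht; lia.
- by rewrite E8 upd_eq.
- split=> //.
  + by move=> u _; rewrite E8 /upd; case: eqP => _; [right|left].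
  + by move=> u _; rewrite E9 /upd; case: eqP => _; [right|left].
  + rewrite E7'; have : 0 < reg s 7 by lia.
    case: (reg s 7) => // N _; rewrite subn1 /= mulnS; move: D3; rewrite E10'.
    move: (\sum_(e < m) mem s 10 e) (\sum_(e < m) mem s' 10 e) => x y; lia.
split.
- have [NaA Na] := (HA a gi).1 Ea; have [NvB Nv] := (HA v gi).2 Ev.
  have [W1 W2 _] := Hstk.
  have Hpath : is_path G a v stk by rewrite /is_path W1 (descends_uniq W2) eqxx.
  exact: valid_routes_rcons NaA NvB Na Nv.
- split.
  + by rewrite size_rcons R //= E19 addn1.
  + by rewrite E20' /unzip2 map_rcons flatten_rcons.
  + split; rewrite map_rcons M //=; have E := E19.
      by have := holds_rcons (v := val a) S0; rewrite size_map -E19 E12.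
    by have := holds_rcons (v := val v) S1; rewrite size_map -E19.
  + rewrite map_rcons M //=.
    by have := holds_rcons (v := size stk) S2; rewrite size_map -E19 E13.
  + by rewrite /unzip2 map_rcons flatten_rcons !M.
- move=> u i; rewrite E8 E9 !map_rcons !mem_rcons !inE !negb_or /upd; split.
    case: eqP => // Eu /(HA u i).1 [-> ->]; split=> //; rewrite andbT.
    by apply: contra_notN Eu => /eqP ->.
  case: eqP => // Eu /(HA u i).2 [-> ->]; split=> //; rewrite andbT.
  by apply: contra_notN Eu => /eqP ->.
- rewrite E8 E9 E7' size_rcons; split=> //; [lia|].
  by have H0 : 0 < reg s 7; lia.
(* An edge of the new path had positive residual capacity, so the unit it loses makes up for the
   larger count. *)
- move=> e; have [Hc Hb] := Hr e; have De := D1 _ (ltn_ord e); rewrite E10' in De.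
  split; first exact: leq_trans De Hc.
  rewrite -cats1 count_cat; move: Hb; set c := count _ rt => Hb /=.
  rewrite addn0; case: (boolP (e \in _)) => [|_] /=; last by lia.
  case/mapP => x Hx Ex.
  have := D2 x Hx; rewrite E10' -Ex.
  by have [_ _ /allP /(_ x Hx)] := Hstk; rewrite /= -Ex => r0 /(_ r0); lia.
Qed.

End Record.

(** * Routing one pair of sets *)

Definition group_init : cmd :=
  Assign 15 (Num 0) ;;
  While (Bin Lt (Reg 15) (Reg 0))
    (Store 12 (Reg 15) (Num 0) ;;
     Store 13 (Reg 15) (Read 7 (Reg 15)) ;;
     Assign 15 (Bin Add (Reg 15) (Num 1))).

Definition group_body : cmd :=
  If (Bin Eq (Read 8 (Reg 12)) (Reg 10)) source Skip ;;
  Assign 12 (Bin Add (Reg 12) (Num 1)).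

Definition group : cmd :=
  group_init ;; Assign 12 (Num 0) ;; While (Bin Lt (Reg 12) (Reg 0)) group_body.

Section Group.
Variables (n m k : nat) (G : multigraph n m) (A B : 'I_k -> {set 'I_n}).
Variables (z l w : nat).
Hypothesis word : big_word n m k l z w.
Hypothesis disj : disjoint_family A B.
Hypothesis AB : forall i, #|A i| <= #|B i|.

Local Notation statics := (statics k G z l).
Local Notation routing_inv := (routing_inv G A B l).
Local Notation route := (route n m).
Local Notation labels i s :=
  (labelling n m l (arc_tl G) (arc_hd G) i (mem s 10) (mem s 12) (mem s 13) (mem s 9)).
Local Notation pot s := (potential n m l (arc_tl G) (mem s 12) (mem s 13)).

(** Arrays 3 and 4 are treated apart because searches write to them; only their recorded prefixes
    have to survive. *)
Lemma routing_inv_same base rt c s s' : same c s s' ->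
  all (fun x => x \notin [:: 7; 19; 20]) (wregs c) ->
  all (fun a => a \notin [:: 0; 1; 2; 8; 9; 10]) (wmems c) ->
  holds (mem s' 3) [seq val x.1 | x <- flatten (unzip2 rt)] ->
  holds (mem s' 4) [seq val x.2 | x <- flatten (unzip2 rt)] ->
  routing_inv base rt s -> routing_inv base rt s'.
Proof.
move=> [R M] HR HM H3 H4 [VR [E19 E20 S01 S2 _] HA HC Hr].
have R' x : x \in [:: 7; 19; 20] -> reg s' x = reg s x.
  by move=> Hx; apply: R; apply/negP => /(allP HR); rewrite Hx.
have M' x : x \in [:: 0; 1; 2; 8; 9; 10] -> mem s' x = mem s x.
  by move=> Hx; apply: M; apply/negP => /(allP HM); rewrite Hx.
split; rewrite ?(M' 8) ?(M' 9) ?(M' 10) ?(R' 7) //.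
by split; rewrite ?(M' 0) ?(M' 1) ?(M' 2) ?(R' 19) ?(R' 20).
Qed.

Lemma source_spec base rt (gi : 'I_k) (a : 'I_n) s :
  statics s -> routing_inv base rt s -> labels gi.+1 s ->
  reg s 10 = gi.+1 -> reg s 12 = a -> mem s 8 a = gi.+1 ->
  spec w source s (fun t s' =>
    [/\ exists rt', routing_inv base rt' s', evolves n m l s s', labels gi.+1 s',
        (forall v, v < n -> mem s 12 v <= mem s' 12 v) /\
        (mem s' 8 a = gi.+1 -> mem s' 12 a = l.+1)
      & t + 26 * pot s' <= 26 * pot s + 16 * l + 60]).
Proof.
move=> Hst RI Hlab E10 E12 Ea.
have [_ offn] := size_routes disj AB RI.
have [_ [_ E20 _ _ [H3 H4]] _ _ _] := RI.
rewrite /source; apply: spec_seq_same.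
  exact (search_spec word Hst E10 E12 E20 offn Hlab H3 H4).
move=> t1 s1 S1 [[stk Hinv] Hfail Ht1].
have [Hlab1 Hstk H14 [H31 H41] [E13 F1 Ev da Hd0]] := Hinv.
have RI1 : routing_inv base rt s1.
  apply: (routing_inv_same S1 _ _ _ _ RI) => //.
  - by move: H31; rewrite map_cat => /holds_cat.
  - by move: H41; rewrite map_cat => /holds_cat.
have ev1 : evolves n m l s s1.
  by split; rewrite ?S1.1 // !S1.2 // => *; left.
apply: spec_if => //= F.
- have {}F : reg s1 14 = 1 by lia.
  have Hl : size stk <= l.
    have [_ W _] := Hstk; have := descends_size W; have := da F.
    by rewrite size_map; lia.
  have E12' : reg s1 12 = a by rewrite S1.1.
  have Ea' : mem s1 8 a = gi.+1 by rewrite S1.2.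
  apply: spec_conseq 
    (spec_same (record_spec word disj AB RI1 E12' Ea' E13 Hstk H14 H31 H41 (Ev F) Hl)) _.
  move=> t s' [S [RI' ev' Ea0 Ht]].
  have E12m : mem s' 12 = mem s1 12 by rewrite S.2.
  have E13m : mem s' 13 = mem s1 13 by rewrite S.2.
  split.
  + by exists (rcons rt ((a, last a (unzip2 stk)), stk)).
  + exact: evolves_trans ev1 ev'.
  + rewrite E12m E13m; case: ev' => Hr _ Hlb _.
    apply: labelling_weaken Hlab1 Hr _ => v /Hlb [->|->] //.
  + by rewrite E12m Ea0; split.
  + rewrite E12m E13m; move: Ht1 Ht; clear; lia.
- apply: spec_skip; split=> //.
  + by exists rt.
  + by split=> // _; apply: Hfail.
  + move: Ht1; clear; lia.
Qed.

Lemma group_init_spec s :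
  statics s ->
  spec w group_init s (fun t s' =>
    [/\ forall v, v < n -> mem s' 12 v = 0,
        forall v, v < n -> mem s' 13 v = mem s' 7 v
      & t <= 4 * n + 2]).
Proof.
move=> Hst; have lin := word_linear word; have w1 : 1 < 2 ^ w by apply: lin; lia.
have w0 : 0 < 2 ^ w by apply: ltnW.
rewrite /group_init; apply: spec_seq_assign => //; set s1 := set_reg _ _ _.
pose I j s' := forall v, v < j -> mem s' 12 v = 0 /\ mem s' 13 v = mem s' 7 v.
apply: spec_conseq (@spec_for w 15 _ _ s1 0 n 3 I (fun=> 0) _ _ _ w1 _ _) _ => //.
- by move=> s' S; split=> //=; rewrite S.1 //; case: Hst => [[]].
- move=> s' j S HI _ jn E15; do 2 apply: spec_seq_store => //=.
  apply: spec_assign; first by fits_split=> //; apply: lin; lia.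
  rewrite /= E15 addn1; split=> // v; rewrite ltnS leq_eqVlt => /orP [/eqP ->|vj] /=.
    by rewrite eqxx.
  by rewrite ltn_eqF //; apply: HI.
- move=> t s' [S HI _ Ht]; split; last by move: Ht; clear; lia.
  + by move=> v /HI [].
  + by move=> v /HI [].
Qed.

Lemma group_spec base rt (gi : 'I_k) s :
  statics s -> routing_inv base rt s -> reg s 10 = gi.+1 ->
  spec w group s (fun t s' =>
    [/\ exists rt', routing_inv base rt' s', evolves n m l s s', labels gi.+1 s',
        forall v, v < n -> mem s' 8 v = gi.+1 -> mem s' 12 v = l.+1
      & t <= 200 * (l.+1 * (n + m) + 1)]).
Proof.
move=> Hst RI E10; have lin := word_linear word; have w1 : 1 < 2 ^ w by apply: lin; lia.
have w0 : 0 < 2 ^ w by apply: ltnW.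
rewrite /group; apply: spec_seq_same (group_init_spec Hst) _ => t1 s1 S1 [D0 P0 Ht1].
have Hst1 : statics s1 by apply: statics_same S1 _ _ Hst.
have [_ [_ _ _ _ [H3 H4]] _ _ _] := RI.
have RI1 : routing_inv base rt s1.
  by apply: (routing_inv_same S1 _ _ _ _ RI) => //; rewrite S1.2.
have Hlab1 : labels gi.+1 s1.
  have [_ _ _ Hadj _] := Hst1.
  exact (labelling_init l (arc_hd G) (@arc_tl_lt _ _ G) Hadj _ _ _ D0 P0).
have ev1 : evolves n m l s s1 by split; rewrite ?S1.1 // !S1.2 // => *; left.
apply: spec_seq_assign => //; set s2 := set_reg _ _ _.
pose I j s' := [/\ exists rt', routing_inv base rt' s', evolves n m l s1 s', labels gi.+1 s'
  & forall v, v < j -> v < n -> mem s' 8 v = gi.+1 -> mem s' 12 v = l.+1].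
apply: spec_conseq (@spec_for w 12 _ _ s2 0 n (16 * l + 64) I (fun s => 26 * pot s)
   _ _ _ w1 _ _) _ => //.
- split=> //; first exists rt.
    apply: (@routing_inv_same _ _ (Assign 12 (Num 0)) s1 _ _ _ _ _ _ RI1) => //;
      rewrite ?S1.2 //.
    by split=> // x; rewrite inE => /negbTE /= ->.
  by split=> // *; left.
- by move=> s' S; split=> //=; rewrite S.1 //=; case: Hst1 => [[]].
- move=> s' j S [[rt' RI'] ev' Hlab' Hdone] _ jn E12.
  have Hst' : statics s'.
    by apply: statics_same S _ _ _ => //; case: Hst1 => [[]] *; split.
  have E10' : reg s' 10 = gi.+1 by rewrite S.1 //= S1.1.
  have fit1 s3 : reg s3 12 = j -> fits w s3 (Bin Add (Reg 12) (Num 1)).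
    by move=> E; fits_split=> //; rewrite E; apply: lin; lia.
  rewrite /group_body.
  apply: (@spec_seq_same _ _ _ _ (fun t s3 =>
    [/\ I j.+1 s3 & t + 26 * pot s3 <= 16 * l + 61 + 26 * pot s'])).
    apply: spec_if => //=; rewrite E12 E10' => Hg.
    + move/nat_bool_neq0/eqP: Hg => Ej.
      have E12o : reg s' 12 = Ordinal jn by [].
      apply: spec_conseq (source_spec Hst' RI' Hlab' E10' E12o Ej) _.
      move=> t s3 [RI3 ev3 Hlab3 [Hd Hj] Ht]; split; last by move: Ht; clear; lia.
      split=> //; first exact: evolves_trans ev' ev3.
      move=> v; rewrite ltnS leq_eqVlt => /orP [/eqP ->|vj] vn //.
      (* A source that failed earlier still has label [l + 1]: labels never decrease, and this is
         their maximum. *)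
      case: ev3 => _ /(_ v vn) [->|-> //] _ _ Ev.
      have := Hd v vn; rewrite Hdone // => H; apply/eqP; rewrite eqn_leq H andbT.
      by case: Hlab3 => _ _ _ _; apply.
    + move/nat_bool_eq0/eqP: Hg => Nj; apply: spec_skip; split; last by lia.
      split=> //; first by exists rt'.
      by move=> v; rewrite ltnS leq_eqVlt => /orP [/eqP -> //|vj]; apply: Hdone.
  move=> t s3 S3 [HI Ht]; have E12' : reg s3 12 = j by rewrite S3.1.
  apply: spec_assign; first exact: fit1.
  by rewrite /= E12' addn1; split=> //; move: Ht; clear; rewrite /=; lia.
- move=> t s' [S [RI' ev' Hlab' Hd] _ Ht]; split=> //.
  + exact: evolves_trans ev1 ev'.
  + by move=> v vn; apply: Hd.
  + have := potential_bound n m l (arc_tl G) (mem s2 12) (mem s2 13).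
    move: Ht Ht1; clear; rewrite subn0.
    set P := potential _ _ _ _ (mem s2 12) _; move: (potential _ _ _ _ _ _) P => P' P.
    nia.
Qed.

End Group.

(** * Cutting off a level set *)

Definition count_levels : cmd :=
  Assign 21 (Num 0) ;;
  While (Bin Lt (Reg 21) (Bin Add (Reg 3) (Num 2)))
    (Store 15 (Reg 21) (Num 0) ;; Assign 21 (Bin Add (Reg 21) (Num 1))) ;;
  Assign 15 (Num 0) ;;
  While (Bin Lt (Reg 15) (Reg 0))
    (If (Read 11 (Reg 15)) Skip
       (Store 15 (Read 12 (Reg 15)) (Bin Add (Read 15 (Read 12 (Reg 15))) (Num 1))) ;;
     Assign 15 (Bin Add (Reg 15) (Num 1))).

(* Subtraction is truncated, so this is the minimum. *)
Definition min_expr (e1 e2 : expr) : expr := Bin Sub e1 (Bin Sub e1 e2).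

Definition find_level : cmd :=
  Assign 23 (Bin Sub (Reg 0) (Reg 11)) ;;
  Assign 21 (Num 0) ;;
  Assign 22 (Read 15 (Num 0)) ;;
  While (Bin Lt (Bin Mul (Bin Mul (Num 8) (Reg 5))
                         (min_expr (Reg 22) (Bin Sub (Reg 23) (Reg 22))))
                (Bin Mul (Reg 3) (min_expr (Read 15 (Reg 21))
                                           (Read 15 (Bin Add (Reg 21) (Num 1))))))
    (Assign 21 (Bin Add (Reg 21) (Num 1)) ;;
     Assign 22 (Bin Add (Reg 22) (Read 15 (Reg 21)))).

Definition add_level : cmd :=
  Assign 24 (Bin Lt (Bin Sub (Reg 23) (Reg 22)) (Reg 22)) ;;
  Assign 15 (Num 0) ;;
  While (Bin Lt (Reg 15) (Reg 0))
    (If (Bin Mul (Bin Eq (Read 11 (Reg 15)) (Num 0))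
                 (Bin Eq (Bin Lt (Reg 21) (Read 12 (Reg 15))) (Reg 24)))
       (Store 11 (Reg 15) (Num 1) ;; Assign 11 (Bin Add (Reg 11) (Num 1)))
       Skip ;;
     Assign 15 (Bin Add (Reg 15) (Num 1))).

Definition level_cut : cmd :=
  If (Bin Lt (Bin Mul (Num 4) (Reg 11)) (Reg 0))
     (count_levels ;; find_level ;; add_level) Skip.

Section LevelCut.
Variables (n m k : nat) (G : multigraph n m).
Variables (z l w : nat).
Hypothesis word : big_word n m k l z w.

Local Notation statics := (statics k G z l).
Local Notation labels i s :=
  (labelling n m l (arc_tl G) (arc_hd G) i (mem s 10) (mem s 12) (mem s 13) (mem s 9)).

Definition in_cut (s : state) : {set 'I_n} := [set v : 'I_n | mem s 11 v != 0].

Definition cut_inv (s : state) : Prop :=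
  (forall v : 'I_n, mem s 11 v <= 1) /\ reg s 11 = #|in_cut s|.

Definition level (X : {set 'I_n}) (d : nat -> nat) (j : nat) : {set 'I_n} :=
  [set v : 'I_n | (v \notin X) && (d v == j)].

Lemma sum_level (X : {set 'I_n}) d j :
  \sum_(i < j) #|level X d i| = #|[set v : 'I_n | (v \notin X) && (d v < j)]|.
Proof.
elim: j => [|j IH].
  by rewrite big_ord0; apply/esym/eqP; rewrite cards_eq0; apply/eqP/setP => v; rewrite !inE andbF.
rewrite big_ord_recr /= IH -(cardsID (level X d j) [set v : 'I_n | (v \notin X) && (d v < j.+1)]).
rewrite addnC; congr (_ + _); apply: eq_card => v; rewrite !inE ltnS.
  by case: (v \in X) => //=; case: ltngtP.
by case: (v \in X) => //=; case: ltngtP.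
Qed.

Lemma card_lt_rcons (P : pred 'I_n) (b : nat) (bn : b < n) :
  #|[set v : 'I_n | P v && (v < b.+1)]| = #|[set v : 'I_n | P v && (v < b)]| + P (Ordinal bn).
Proof.
rewrite (cardsD1 (Ordinal bn)) inE /= ltnSn andbT addnC; congr (_ + _).
apply: eq_card => v; rewrite !inE -val_eqE /= ltnS.
by case: (P v); rewrite ?andbF //=; case: ltngtP.
Qed.

Lemma nat_bool_eq (b c : bool) : (nat_of_bool b == nat_of_bool c) = (b == c).
Proof. by case: b; case: c. Qed.

Lemma count_levels_spec s :
  statics s -> (forall v, v < n -> mem s 12 v <= l.+1) ->
  spec w count_levels s (fun t s' =>
    (forall j, j < l.+2 -> mem s' 15 j = #|level (in_cut s) (mem s 12) j|) /\
    t <= 10 * (n + l + 2)).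
Proof.
move=> Hst Hd; have lin := word_linear word; have w1 : 1 < 2 ^ w by apply: lin; lia.
have w0 : 0 < 2 ^ w by apply: ltnW.
have [[E0 _ _ E3 _] _ _ _ _] := Hst.
rewrite /count_levels; apply: spec_seq_assign => //; set s1 := set_reg _ _ _.
pose I1 j s' := forall i, i < j -> mem s' 15 i = 0.
apply: (@spec_seq_same _ _ _ _ (fun t s' => I1 l.+2 s' /\ t <= 3 * (l + 2) + 1)).
  apply: spec_conseq (@spec_for w 21 _ _ s1 0 l.+2 2 I1 (fun=> 0) _ _ _ w1 _ _) _ => //.
  - move=> s' S; have E3' : reg s' 3 = l by rewrite S.1.
    by split; [fits_split=> //; apply: lin; lia | rewrite /= E3' addn2].
  - move=> s' j S HI _ jl E21; apply: spec_seq_store => //=.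
    apply: spec_assign; first by fits_split=> //; apply: lin; lia.
    rewrite /= E21 addn1; split=> // i; rewrite ltnS leq_eqVlt => /orP [/eqP ->|ij] /=.
      by rewrite eqxx.
    by rewrite ltn_eqF //; apply: HI.
  - by move=> t s' [S HI _ Ht]; split=> //; move: Ht; clear; lia.
move=> t1 s2 S2 [HI1 Ht1]; apply: spec_seq_assign => //; set s3 := set_reg _ _ _.
pose P (j : nat) (v : 'I_n) := (v \notin in_cut s) && (mem s 12 v == j).
pose I b s' := forall j, j < l.+2 -> mem s' 15 j = #|[set v : 'I_n | P j v && (v < b)]|.
apply: spec_conseq (@spec_for w 15 _ _ s3 0 n 3 I (fun=> 0) _ _ _ w1 _ _) _ => //.
- move=> j Hj; rewrite /= HI1 //; apply/esym/eqP; rewrite cards_eq0; apply/eqP/setP => v.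
  by rewrite !inE andbF.
- by move=> s' S; split=> //=; rewrite S.1 //= S2.1.
- move=> s' b S HI _ bn E15.
  have M11 : mem s' 11 = mem s 11 by rewrite S.2 //= S2.2.
  have M12 : mem s' 12 = mem s 12 by rewrite S.2 //= S2.2.
  have PE j : P j (Ordinal bn) = (mem s 11 b == 0) && (mem s 12 b == j) by rewrite /P inE negbK.
  have cw j : #|[set v : 'I_n | P j v && (v < b)]| + 1 < 2 ^ w.
    apply: lin; have : #|[set v : 'I_n | P j v && (v < b)]| <= n.
      by rewrite -[leqRHS]card_ord max_card.
    lia.
  apply: (@spec_seq_same _ _ _ _ (fun t s'' => I b.+1 s'' /\ t <= 2)).
    apply: spec_if => //=; rewrite E15 M11 ?M12 => H.
    + apply: spec_skip; split=> // j Hj; rewrite HI // (card_lt_rcons _ bn) PE.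
      by move: H; case: (mem s 11 b) => //=; rewrite addn0.
    + have db : mem s 12 b < l.+2 by rewrite ltnS; apply: Hd.
      have Ed : mem s' 12 (reg s' 15) = mem s 12 b by rewrite E15 M12.
      apply: spec_store; rewrite /= ?Ed //; first by fits_split=> //=; rewrite HI.
      split=> // j Hj; rewrite (card_lt_rcons _ bn) PE H eqxx /= -HI //.
      by rewrite eq_sym; case: eqP => [->|]; rewrite ?addn0 // HI.
  move=> t s4 S4 [HI4 Ht]; have E15' : reg s4 15 = b by rewrite S4.1.
  apply: spec_assign; first by fits_split=> //; rewrite E15'; apply: lin; lia.
  by rewrite /= E15' addn1; split=> //; move: Ht; clear; lia.
- move=> t s' [S HI _ Ht]; split; last by move: Ht Ht1; clear; lia.
  move=> j Hj; rewrite HI //; apply: eq_card => v; rewrite !inE /P ltn_ord andbT.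
  by rewrite inE.
Qed.

Lemma find_level_spec s (X : {set 'I_n}) d :
  statics s -> 1 < n -> 0 < l -> reg s 11 = #|X| ->
  (forall v, v < n -> d v <= l.+1) ->
  (forall j, j < l.+2 -> mem s 15 j = #|level X d j|) ->
  spec w find_level s (fun t s' =>
    let lo := #|[set v : 'I_n | (v \notin X) && (d v < (reg s' 21).+1)]| in
    let j := reg s' 21 in
    [/\ j <= l, reg s' 22 = lo, reg s' 23 = #|~: X|,
        l * minn #|level X d j| #|level X d j.+1| <=
          8 * log n * minn lo (#|~: X| - lo)
      & t <= 3 * l + 10]).
Proof.
move=> Hst n1 l0 E11 Hd Hcnt; have lin := word_linear word.
have w1 : 1 < 2 ^ w by apply: lin; lia.
have w0 : 0 < 2 ^ w by apply: ltnW.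
have [[E0 _ _ E3 _] E5 _ _ _] := Hst.
have Xn : #|X| <= n by rewrite -[leqRHS]card_ord max_card.
have CX : #|~: X| = n - #|X| by rewrite [LHS]cardsCs setCK card_ord.
have tot : \sum_(j < l.+2) #|level X d j| = #|~: X|.
  rewrite sum_level; apply: eq_card => v; rewrite !inE ltnS Hd //.
  by rewrite andbT.
have L0 : 0 < log n by rewrite /log trunc_log_gt0.
have LN : log n <= n by apply: leq_trans (ltnW (ltn_expl _ _)) (trunc_logP _ _) => //; lia.
have ltn2 : n < 2 ^ (log n).+1 by apply: trunc_log_ltn.
(* This gives a level [js] beyond which the scan cannot run; it may stop earlier at another good
   level. *)
have := @sparse_level (fun j => #|level X d j|) l (log n) l0 L0.
rewrite tot => /(_ _) [|js jsl]; first by lia.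
set lo := fun j => \sum_(i < j) #|level X d i|; rewrite -/(lo _) => good.
have lo_le j : j <= l.+2 -> lo j <= n.
  move=> Hj; rewrite /lo sum_level -[leqRHS]card_ord; exact: max_card.
rewrite /find_level; apply: spec_seq_assign.
  by fits_split=> //; rewrite E0 E11; apply: lin; lia.
do 2 apply: spec_seq_assign => //=.
set s1 := set_reg _ 22 _.
set body := _ ;; _; set guard := Bin Lt _ _.
have stat s' : same (While guard body) s1 s' ->
  [/\ reg s' 3 = l, reg s' 5 = log n, reg s' 23 = #|~: X|
    & forall j, j < l.+2 -> mem s' 15 j = #|level X d j|].
  move=> [R M]; split; rewrite ?R ?M ?CX //= ?E0 ?E11 //.
pose I s' := reg s' 21 <= js /\ reg s' 22 = lo (reg s' 21).+1.
have levn j : #|level X d j| <= n by rewrite -[leqRHS]card_ord max_card.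
pose mu s' := 3 * (js - reg s' 21).
have Ltot : #|~: X| <= n by rewrite -[leqRHS]card_ord max_card.
apply: spec_conseq (@spec_while w guard body s1 I mu _ _ _) _.
- by split=> //=; rewrite Hcnt // /lo big_ord1.
- move=> s' /stat [E3' E5' E23' H15] [Hj H22].
  have c1 := levn (reg s' 21); have c2 := levn (reg s' 21).+1.
  have lon := lo_le (reg s' 21).+1 ltac:(lia).
  fits_split=> //; rewrite /= ?E3' ?E5' ?E23' ?H22 -?minnE ?addn1 ?H15; try lia.
  all: try by apply: lin; lia.
  - by rewrite -mulnA; apply: (word_mul word) => //; lia.
  - by apply: (word_mul1 word); lia.
- move=> s' S [Hj H22] Hg; have [E3' E5' E23' H15] := stat _ S.
  have lj : reg s' 21 < js.
    rewrite ltn_neqAle Hj andbT; apply/negP => /eqP Ej.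
    by move: Hg; rewrite /= E3' E5' E23' H22 -!minnE addn1 !H15 ?Ej; lia.
  rewrite /body; apply: spec_seq_assign; first by fits_split=> //; apply: lin; lia.
  have E21 : reg s' 21 + 1 < l.+2 by lia.
  apply: spec_assign => /=.
    fits_split=> //; rewrite H15 // H22 addn1 -[_ + _]/(lo _.+1 + _).
    apply: lin; have := lo_le (reg s' 21).+2; rewrite {1}/lo big_ord_recr -/(lo _) /=; lia.
  rewrite /I /mu /= addn1 H15 ?H22; last by lia.
  split; last by lia.
  by split; [|rewrite /lo [RHS]big_ord_recr].
- move=> t s' [S [Hj H22] Hg Ht]; have [E3' E5' E23' H15] := stat _ S.
  split=> //.
  + exact: leq_trans Hj jsl.
  + by rewrite H22 /lo sum_level.
  + move: Hg; rewrite /= E3' E5' E23' H22 -!minnE addn1 !H15; try lia.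
    by move/nat_bool_eq0; rewrite -leqNgt /lo sum_level.
  + by move: Ht; rewrite /mu /=; lia.
Qed.

(** [side] is true when the part above level [j] is strictly smaller than the part up to it, so the
    smaller part joins the cut. *)
Lemma add_level_spec s (X : {set 'I_n}) j :
  statics s -> cut_inv s -> X = in_cut s -> reg s 21 = j ->
  reg s 22 <= n -> reg s 23 <= n ->
  let side := reg s 23 - reg s 22 < reg s 22 in
  spec w add_level s (fun t s' =>
    [/\ cut_inv s', in_cut s' = X :|: [set v : 'I_n | (v \notin X) && ((j < mem s 12 v) == side)]
      & t <= 6 * n + 5]).
Proof.
move=> Hst [X1 E11] EX E21 H22 H23 side.
have lin := word_linear word; have w1 : 1 < 2 ^ w by apply: lin; lia.
have w0 : 0 < 2 ^ w by apply: ltnW.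
have [[E0 _ _ E3 _] E5 _ _ _] := Hst.
rewrite /add_level; apply: spec_seq_assign; first by fits_split=> //; apply: lin; lia.
apply: spec_seq_assign => //; set s1 := set_reg _ 15 _.
pose P (v : 'I_n) := (v \notin X) && ((j < mem s 12 v) == side).
pose I b s' := [/\ forall v : 'I_n, mem s' 11 v = (v \in X) || P v && (v < b)
  & reg s' 11 = #|X| + #|[set v : 'I_n | P v && (v < b)]|].
apply: spec_conseq (@spec_for w 15 _ _ s1 0 n 5 I (fun=> 0) _ _ _ w1 _ _) _ => //.
- split=> [v|] /=.
    by rewrite andbF orbF EX inE; have := X1 v; case: (mem s 11 v) => [|[]].
  rewrite EX -E11 -[LHS]addn0; congr (_ + _); apply/esym/eqP; rewrite cards_eq0.
  by apply/eqP/setP => v; rewrite !inE andbF.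
- by move=> s' S; split=> //=; rewrite S.1.
- move=> s' b S [H11 E11'] _ bn E15.
  have M12 : mem s' 12 = mem s 12 by rewrite S.2.
  have E21' : reg s' 21 = j by rewrite S.1.
  have E24' : reg s' 24 = side by rewrite S.1.
  have fit1 s4 : reg s4 15 = b -> fits w s4 (Bin Add (Reg 15) (Num 1)).
    by move=> E; fits_split=> //; rewrite E; apply: lin; lia.
  have PE : P (Ordinal bn) = (mem s' 11 b == 0) && ((j < mem s 12 b) == side).
    rewrite (H11 (Ordinal bn)) /= /P; case: (_ \in X) => //=.
    by rewrite ltnn andbF.
  have XPn : #|X| + #|[set v : 'I_n | P v && (v < b)]| <= n.
    rewrite -cardsUI; have -> : X :&: [set v : 'I_n | P v && (v < b)] = set0.
      by apply/setP => v; rewrite !inE /P; case: (v \in X).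
    by rewrite cards0 addn0 -[leqRHS]card_ord max_card.
  apply: (@spec_seq_same _ _ _ _ (fun t s4 => I b.+1 s4 /\ t <= 3)).
    apply: spec_if; rewrite /= E15 ?E21' ?M12 ?E24'.
    + fits_split=> //; apply: leq_ltn_trans w1.
      by rewrite -[leqRHS]muln1 leq_mul // leq_b1.
    + rewrite nat_bool_muln nat_bool_eq => /nat_bool_neq0 H.
      have Pb : P (Ordinal bn) by rewrite PE.
      apply: spec_seq_store => //=; apply: spec_assign.
        by fits_split=> //=; rewrite E11'; apply: lin; lia.
      split=> //; split=> [v|] /=.
        rewrite E15 -[v < b.+1]/(v <= b) leq_eqVlt -[nat_of_ord v == b]/(v == Ordinal bn).
        case: eqP => [->|_] /=; last exact: H11.
        by rewrite Pb orbT.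
      by rewrite E11' (card_lt_rcons _ bn) Pb addnA.
    + rewrite nat_bool_muln nat_bool_eq => /nat_bool_eq0 H.
      have Pb : P (Ordinal bn) = false by rewrite PE; apply/negbTE.
      apply: spec_skip; split=> //; split=> [v|]; last first.
        by rewrite E11' (card_lt_rcons _ bn) Pb addn0.
      rewrite H11 ltnS [v <= b]leq_eqVlt -[nat_of_ord v == b]/(v == Ordinal bn).
      by case: eqP => [->|_] //=; rewrite Pb.
  move=> t s4 S4 [HI Ht]; have E15' : reg s4 15 = b by rewrite S4.1.
  apply: spec_assign; first exact: fit1.
  by rewrite /= E15' addn1; split=> //; move: Ht; clear; lia.
- move=> t s' [S [H11 E11'] _ Ht].
  have EX' : in_cut s' = X :|: [set v : 'I_n | P v].
    by apply/setP => v; rewrite !inE H11 ltn_ord andbT; case: (_ || _).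
  split=> //; last by move: Ht; clear; lia.
  split; first by move=> v; rewrite H11; apply: leq_b1.
  rewrite E11' EX' cardsU; have -> : X :&: [set v | P v] = set0.
    by apply/setP => v; rewrite !inE /P; case: (v \in X).
  rewrite cards0 subn0; congr (_ + _); apply: eq_card => v.
  by rewrite !inE ltn_ord andbT.
Qed.

Lemma level_cut_spec i s :
  statics s -> 1 < n -> 0 < l -> cut_inv s -> labels i s ->
  (forall v, v < n -> mem s 8 v = i -> mem s 12 v = l.+1) ->
  let X := in_cut s in
  spec w level_cut s (fun t s' =>
    let X' := in_cut s' in
    [/\ cut_inv s', X \subset X',
        4 * #|X| < n -> 2 * #|X'| <= n + #|X| /\
          ((forall v : 'I_n, mem s 8 v = i -> v \in X') \/
           (forall v : 'I_n, mem s 9 v = i -> v \in X')),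
        l * #|crossing G X' (mem s 10)| + 8 * log n * (max_degree G * #|X|) <=
          l * #|crossing G X (mem s 10)| + 8 * log n * (max_degree G * #|X'|)
          /\ (n <= 4 * #|X| -> X' = X)
      & t <= 30 * (n + l + 2)]).
Proof.
move=> Hst n1 l0 HX Hlab Hfail X.
have lin := word_linear word; have w1 : 1 < 2 ^ w by apply: lin; lia.
have [[E0 _ _ E3 _] E5 _ _ _] := Hst; have E11 : reg s 11 = #|X| := HX.2.
have EX : in_cut s = X by []; clearbody X.
have [HV HB _ _ HD] := Hlab.
have Xn : #|X| <= n by rewrite -[leqRHS]card_ord max_card.
rewrite /level_cut; apply: spec_if.
- by fits_split=> //=; rewrite ?E11; apply: lin; lia.
- rewrite /= E11 E0 => /nat_bool_neq0 Xsmall.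
  apply: (spec_seq_same (count_levels_spec Hst HD)) => t1 s1 S1 [Hcnt Ht1].
  rewrite EX in Hcnt.
  have Hst1 : statics s1 by apply: (statics_same S1).
  have E11' : reg s1 11 = #|X| by rewrite S1.1.
  apply: (spec_seq_same (find_level_spec Hst1 n1 l0 E11' HD Hcnt)) => t2 s2 S2.
  move=> [Hj H22 H23 Hgood Ht2]; set j := reg s2 21 in Hj H22 Hgood.
  have Hst2 : statics s2 by apply: (statics_same S2).
  have M11 : mem s2 11 = mem s 11 by rewrite S2.2 // S1.2.
  have M12 : mem s2 12 = mem s 12 by rewrite S2.2 // S1.2.
  have EX2 : X = in_cut s2 by rewrite -EX /in_cut M11.
  have HX2 : cut_inv s2 by split; [rewrite M11; apply: HX.1 | rewrite -EX2 S2.1].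
  set lo := #|_| in H22 Hgood.
  have lo_le : lo <= #|~: X|.
    by apply: subset_leq_card; apply/subsetP => v; rewrite !inE => /andP [].
  have CX : #|X| + #|~: X| = n by rewrite cardsC card_ord.
  apply: spec_conseq (spec_same (add_level_spec Hst2 HX2 EX2 (erefl j) _ _)) _; try lia.
  move=> t s' [S3 [HX' EX' Ht]].
  set side := _ < _ in EX'; rewrite M12 in EX'; set S := [set v | _] in EX'.
  have disjS : X :&: S = set0.
    by apply/setP => v; rewrite !inE; case: (v \in X).
  have cX' : #|in_cut s'| = #|X| + #|S| by rewrite EX' cardsU disjS cards0 subn0.
  have lohi : lo + #|[set v : 'I_n | (v \notin X) && (j < mem s 12 v)]| = #|~: X|.
    rewrite -(cardsID [set v : 'I_n | mem s 12 v < j.+1] (~: X)).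
    congr (_ + _); apply: eq_card => v.
      by rewrite !inE.
    by rewrite !inE ltnS -ltnNge andbC.
  have cS : #|S| = minn lo (#|~: X| - lo).
    rewrite /S /side H22 H23; case: ltnP => C.
      rewrite -lohi addKn; apply: eq_card => v; rewrite !inE.
      by case: (_ < _).
    apply: eq_card => v; rewrite !inE ltnS [_ <= j]leqNgt.
    by case: (_ < _).
  split=> //.
  + by rewrite EX' subsetUl.
  + move=> _; split; first by move: lo_le CX; rewrite cX' cS; move: (lo) #|X| #|~: X|; clear; lia.
    have in' v : (v \in X) || ((j < mem s 12 v) == side) -> v \in in_cut s'.
      by rewrite EX' in_setU => /orP [-> //|H]; case: (boolP (v \in X)) => //= vX; rewrite inE vX.
    case: (boolP side) => Hside; [left | right] => v Ev; apply: in'; apply/orP; right.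
      by rewrite Hfail // ltnS Hj Hside.
    by rewrite HB // (negbTE Hside).
  + split; last by rewrite leqNgt Xsmall.
    rewrite cX' EX'.
    have lip (e : 'I_m) : 0 < mem s 10 e ->
        mem s 12 (ends G e).1 <= (mem s 12 (ends G e).2).+1 /\
        mem s 12 (ends G e).2 <= (mem s 12 (ends G e).1).+1.
      move=> re; have [p [q [[P1 P2 P3 P4] [Q1 Q2 Q3 Q4]]]] := edge_arcs G e.
      have := HV _ P1; have := HV _ Q1; rewrite P2 P3 P4 Q2 Q3 Q4.
      by move=> /(_ re) ? /(_ re) ?.
    have := crossing_level lip (erefl S); rewrite -!/(level X _ _).
    set M := minn _ _ in Hgood * => H; rewrite -cS in Hgood.
    have H2 : l * (max_degree G * M) <= 8 * log n * (max_degree G * #|S|).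
      by rewrite mulnCA [leqRHS]mulnCA leq_mul2l Hgood orbT.
    rewrite !mulnDr [leqRHS]addnCA [leqLHS]addnC leq_add2l.
    apply: leq_trans (leq_mul (leqnn l) H) _.
    by rewrite mulnDr leq_add2l.
  + move: Ht Ht1 Ht2; clear; lia.
- rewrite /= E11 E0 => /nat_bool_eq0; rewrite -leqNgt => Xbig.
  apply: spec_skip => /=; rewrite EX; split=> //; last by clear; lia.
  by rewrite ltnNge Xbig.
Qed.

End LevelCut.

(** * Rounds *)

Definition reset : cmd :=
  Assign 8 (Reg 7) ;;
  Assign 18 (Num 0) ;;
  While (Bin Lt (Reg 18) (Reg 1))
    (Store 10 (Reg 18) (Reg 6) ;; Assign 18 (Bin Add (Reg 18) (Num 1))) ;;
  Assign 15 (Num 0) ;;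
  While (Bin Lt (Reg 15) (Reg 0))
    (Store 11 (Reg 15) (Num 0) ;; Assign 15 (Bin Add (Reg 15) (Num 1))) ;;
  Assign 11 (Num 0).

Definition groups : cmd :=
  Assign 10 (Num 1) ;;
  While (Bin Lt (Reg 10) (Bin Add (Reg 2) (Num 1)))
    (group ;; level_cut ;; Assign 10 (Bin Add (Reg 10) (Num 1))).

Definition round : cmd :=
  reset ;;
  groups ;;
  Assign 9 (Bin Mul (Bin Lt (Reg 4) (Reg 7)) (Bin Lt (Reg 8) (Bin Mul (Num 2) (Reg 7)))).

Definition main_loop : cmd :=
  While (Bin Mul (Bin Eq (Reg 9) (Num 0)) (Bin Lt (Reg 4) (Reg 7))) round.

Section Rounds.
Variables (n m k : nat) (G : multigraph n m) (A B : 'I_k -> {set 'I_n}).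
Variables (z l w : nat).
Hypothesis word : big_word n m k l z w.

Local Notation statics := (statics k G z l).
Local Notation routing_inv := (routing_inv G A B l).

Definition good_cut (X : {set 'I_n}) : Prop :=
  [/\ X != set0, ~: X != set0, z <= 2 * #|X|, z <= 2 * #|~: X|
    & l * #|edges_between G X (~: X)| <= 72 * log n * (max_degree G * minn #|X| #|~: X|)].

(** [s0] is the state after the reset, and the pairs of sets before the [j]-th are done. The
    alternative for each pair is claimed only while [X] is below [n / 4], because nothing is added
    afterwards. *)
Definition round_inv (s0 : state) (j : nat) (s : state) : Prop :=
  [/\ evolves n m l s0 s, cut_inv n s,
      l * #|crossing G (in_cut n s) (mem s 10)| <= 8 * log n * (max_degree G * #|in_cut n s|),
      8 * #|in_cut n s| <= 5 * n
    & 4 * #|in_cut n s| < n -> forall i : 'I_k, i.+1 < j ->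
        (forall v : 'I_n, mem s 8 v = i.+1 -> v \in in_cut n s) \/
        (forall v : 'I_n, mem s 9 v = i.+1 -> v \in in_cut n s)].

Lemma reset_spec base rt s :
  statics s -> routing_inv base rt s ->
  spec w reset s (fun t s' =>
    [/\ routing_inv (base + cap n l) rt s', round_inv s' 1 s', reg s' 8 = reg s 7,
        \sum_(e < m) mem s' 10 e = m * cap n l
      & t <= 5 * (n + m) + 10]).
Proof.
move=> Hst RI; have lin := word_linear word; have w1 : 1 < 2 ^ w by apply: lin; lia.
have w0 : 0 < 2 ^ w by apply: ltnW.
have [[E0 E1 _ E3 _] E5 E6 _ _] := Hst.
rewrite /reset; do 2 apply: spec_seq_assign => //; set s1 := set_reg _ 18 _.
pose I1 j s' := forall e, e < j -> mem s' 10 e = cap n l.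
apply: (@spec_seq_same _ _ _ _ (fun t s' => I1 m s' /\ t <= 3 * m + 1)).
  apply: spec_conseq (@spec_for w 18 _ _ s1 0 m 2 I1 (fun=> 0) _ _ _ w1 _ _) _ => //.
  - by move=> s' S; split=> //=; rewrite S.1.
  - move=> s' e S HI _ em E18; apply: spec_seq_store => //.
    apply: spec_assign; first by fits_split=> //; apply: lin; lia.
    rewrite /= E18 addn1; split=> // e'; rewrite ltnS leq_eqVlt => /orP [/eqP ->|ee] /=.
      by rewrite eqxx S.1.
    by rewrite ltn_eqF //; apply: HI.
  - by move=> t s' [S HI _ Ht]; split=> //; move: Ht; clear; lia.
move=> t2 s2 S2 [HI1 Ht2]; apply: spec_seq_assign => //; set s3 := set_reg _ _ _.
pose I2 j s' := forall v, v < j -> mem s' 11 v = 0.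
apply: (@spec_seq_same _ _ _ _ (fun t s' => I2 n s' /\ t <= 3 * n + 1)).
  apply: spec_conseq (@spec_for w 15 _ _ s3 0 n 2 I2 (fun=> 0) _ _ _ w1 _ _) _ => //.
  - by move=> s' S; split=> //=; rewrite S.1 //= S2.1.
  - move=> s' v S HI _ vn E15; apply: spec_seq_store => //.
    apply: spec_assign; first by fits_split=> //; apply: lin; lia.
    rewrite /= E15 addn1; split=> // v'; rewrite ltnS leq_eqVlt => /orP [/eqP ->|vv] /=.
      by rewrite eqxx.
    by rewrite ltn_eqF //; apply: HI.
  - by move=> t s' [S HI _ Ht]; split=> //; move: Ht; clear; lia.
move=> t4 s4 S4 [HI2 Ht4]; apply: spec_assign => //; set s5 := set_reg _ _ _.
have M x : x \in [:: 0; 1; 2; 3; 4; 8; 9] -> mem s5 x = mem s x.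
  rewrite !inE => Hx; rewrite /= S4.2 /= ?S2.2 //=; rewrite inE;
    by move: Hx; do !case: eqP => [->|_] //.
have R x : x \in [:: 7; 19; 20] -> reg s5 x = reg s x.
  rewrite !inE => /or3P [] /eqP ->; rewrite /= S4.1 /= ?S2.1 //=.
have M10 (e : 'I_m) : mem s5 10 e = cap n l by rewrite /= S4.2 //= HI1.
have X0 : in_cut n s5 = set0.
  by apply/setP => v; rewrite !inE /= HI2.
split.
- have [VR [E19 E20 [S0 S1] S22 [S3 S44]] HA HC Hr] := RI.
  split; rewrite ?(M 8) ?(M 9) ?(R 7) //.
    by split; rewrite ?(M 0) ?(M 1) ?(M 2) ?(M 3) ?(M 4) ?(R 19) ?(R 20).
  by move=> e; rewrite M10; split=> //; have := (Hr e).2; lia.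
- split; rewrite ?X0 ?cards0 ?muln0 //.
  + exact: evolves_refl.
  + split; last by rewrite X0 cards0.
    by move=> v; rewrite /= HI2.
  + rewrite (_ : crossing _ _ _ = set0) ?cards0 ?muln0 //.
    by apply/setP => e; rewrite !inE /= ?andbF.
- by rewrite /= S4.1 //= S2.1.
- by rewrite (eq_bigr (fun=> cap n l)) // sum_nat_const card_ord.
- move: Ht2 Ht4; clear; lia.
Qed.

Lemma round_inv_group s0 j s s' :
  round_inv s0 j s -> evolves n m l s s' -> mem s' 11 = mem s 11 -> reg s' 11 = reg s 11 ->
  round_inv s0 j s'.
Proof.
move=> [ev [C1 C2] X1 X2 X3] ev' M11 R11.
have EX : in_cut n s' = in_cut n s by rewrite /in_cut M11.
have [Hr Ha Hb _] := ev'; split; rewrite ?EX //.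
- exact: evolves_trans ev ev'.
- by split; [rewrite M11 | rewrite R11 EX].
(* Capacities only drop, so the unsaturated boundary of a fixed [X] can only shrink. *)
- apply: leq_trans X1; rewrite leq_mul2l; apply/orP; right; apply: subset_leq_card.
  apply/subsetP => e; rewrite !in_set => /andP [-> H]; apply: leq_trans H _; exact: Hr.
- move=> /X3 H i Hi; case: (H i Hi) => Hv; [left|right] => v Ev; apply: Hv.
    by case: (Ha _ (ltn_ord v)) => E; rewrite -E ?Ev //; rewrite E in Ev.
  by case: (Hb _ (ltn_ord v)) => E; rewrite -E ?Ev //; rewrite E in Ev.
Qed.

Hypothesis disj : disjoint_family A B.

(** For each pair of sets, choose the side contained in [X]. The chosen sides are disjoint, and each
    has at least as many vertices as the pair has unrouted sources, because the free targets are no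
    fewer. *)
Lemma unrouted_bound base rt s0 s :
  routing_inv base rt s -> round_inv s0 k.+1 s -> 4 * #|in_cut n s| < n ->
  reg s 7 <= #|in_cut n s|.
Proof.
move=> [_ _ HA [C1 C2 _] _] [_ _ _ _ X3] /X3 H.
set X := in_cut n s in H *.
pose LA (i : 'I_k) := [set v : 'I_n | mem s 8 v == i.+1].
pose LB (i : 'I_k) := [set v : 'I_n | mem s 9 v == i.+1].
pose T i := if LA i \subset X then LA i else LB i.
have TX i : T i \subset X.
  rewrite /T; case: ifP => // NA; case: (H i) => [|Hv|Hv]; first by rewrite ltnS.
    by case/negP: (negbT NA); apply/subsetP => v; rewrite inE => /eqP; apply: Hv.
  by apply/subsetP => v; rewrite inE => /eqP; apply: Hv.
have [D1 D2 D3] := disj.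
have Tdisj i j : i != j -> [disjoint T i & T j].
  move=> ij; rewrite -setI_eq0; apply/eqP/setP => v; rewrite !inE; apply/negP.
  rewrite /T; case: ifP => _; case: ifP => _; rewrite !inE => /andP [/eqP H1 /eqP H2].
  - by case/eqP: ij; apply: val_inj; move: H1; rewrite H2 => -[].
  - have [HvA _] := (HA v i).1 H1; have [HvB _] := (HA v j).2 H2.
    by rewrite (disjointFr (D1 i j) HvA) in HvB.
  - have [HvB _] := (HA v i).2 H1; have [HvA _] := (HA v j).1 H2.
    by rewrite (disjointFr (D1 j i) HvA) in HvB.
  - by case/eqP: ij; apply: val_inj; move: H1; rewrite H2 => -[].
rewrite C2; apply: (@leq_trans (\sum_(i < k) #|T i|)).
  by apply: leq_sum => i _; rewrite /T; case: ifP => // _; apply: C1.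
rewrite -card_bigcup_disjoint //; apply: subset_leq_card.
by apply/bigcupsP => i _.
Qed.

Hypothesis AB : forall i, #|A i| <= #|B i|.
Hypothesis l0 : 0 < l.

Definition group_time : nat := 240 * (l.+1 * (n + m) + l + 3).

Lemma groups_spec base rt s :
  statics s -> 1 < n -> routing_inv base rt s -> round_inv s 1 s ->
  spec w groups s (fun t s' =>
    [/\ exists rt', routing_inv base rt' s', round_inv s k.+1 s'
      & t <= k * group_time + 2]).
Proof.
move=> Hst n1 RI RX; have lin := word_linear word; have w1 : 1 < 2 ^ w by apply: lin; lia.
have w0 : 0 < 2 ^ w by apply: ltnW.
have [[E0 E1 E2 E3 _] E5 E6 _ _] := Hst.
rewrite /groups; apply: spec_seq_assign => //; set s1 := set_reg _ _ _.
pose I j s' := (exists rt', routing_inv base rt' s') /\ round_inv s j s'.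
apply: spec_conseq (@spec_for w 10 _ _ s1 1 k.+1 group_time.-1 I (fun=> 0) _ _ _ w1 _ _) _ => //.
- by split=> //; exists rt.
- move=> s' S; have E2' : reg s' 2 = k by rewrite S.1.
  by split; [fits_split=> //; rewrite E2'; apply: lin; lia | rewrite /= E2' addn1].
- move=> s' [//|i] S [[rt' RI'] RX'] _ ik E10.
  have Hst' : statics s'.
    by apply: (statics_same S) => //; case: Hst => [[]] *; split.
  rewrite ltnS in ik; pose gi := Ordinal ik.
  apply: (spec_seq_same (group_spec word disj AB (gi := gi) Hst' RI' E10)).
  move=> t2 s2 S2 [[rt2 RI2] ev2 Hlab Hfail Ht2].
  have RX2 : round_inv s i.+1 s2 by apply: round_inv_group RX' ev2 _ _; rewrite ?S2.1 ?S2.2.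
  have Hst2 : statics s2 by apply: (statics_same S2).
  have [ev [C1 C2] X1 X2 X3] := RX2.
  apply: (spec_seq_same (level_cut_spec word Hst2 n1 l0 (conj C1 C2) Hlab Hfail)).
  move=> t3 s3 S3 [HX3 Xsub Hsmall [Hcross Hbig] Ht3].
  have M10 : mem s3 10 = mem s2 10 by rewrite S3.2.
  have M8 : mem s3 8 = mem s2 8 by rewrite S3.2.
  have M9 : mem s3 9 = mem s2 9 by rewrite S3.2.
  have RI3 : routing_inv base rt2 s3.
    have [_ [_ _ _ _ [H3 H4]] _ _ _] := RI2.
    by apply: (routing_inv_same S3 _ _ _ _ RI2) => //; rewrite S3.2.
  have E10' : reg s3 10 = i.+1 by rewrite S3.1 // S2.1.
  apply: spec_assign; first by fits_split=> //; rewrite E10'; apply: lin; lia.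
  rewrite /= E10' addn1; split=> //; last first.
    by rewrite /group_time; move: Ht2 Ht3; clear; lia.
  split; first by exists rt2.
  set X := in_cut n s2 in X1 X2 X3 Xsub Hsmall Hcross Hbig.
  set X' := in_cut n s3 in Xsub Hsmall Hcross Hbig.
  have E3X : in_cut n (set_reg s3 10 i.+2) = X' by [].
  have X'5 : 8 * #|X'| <= 5 * n.
    case: (ltnP (4 * #|X|) n) => [H|/Hbig -> //].
    by have [H2 _] := Hsmall H; move: H H2; clear; lia.
  have XX' : #|X| <= #|X'| := subset_leq_card Xsub.
  split; rewrite ?E3X ?[mem (set_reg _ _ _) _]/= ?M10 ?M8 ?M9 //.
  + apply: (evolves_trans ev); split; rewrite /= ?M10 ?M8 ?M9 ?S3.1 // => *; by left.
  + by move: Hcross X1; clear; lia.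
  + move=> X'small i'; rewrite ltnS leq_eqVlt => Hi'.
    (* The cut only grows, so it was below [n / 4] before this addition as well, and the guarantees
       for earlier pairs apply. *)
    have Xsmall : 4 * #|X| < n by move: XX' X'small; clear; lia.
    case/orP: Hi' => [/eqP [E]|Hi'].
      by have [_] := Hsmall Xsmall; rewrite E.
    by case: (X3 Xsmall i' Hi') => Hv; [left|right] => v /Hv; apply: (subsetP Xsub).
- move=> t s' [S [RI' RX'] _ Ht]; split=> //.
  have E : group_time.-1.+1 = group_time by rewrite prednK // /group_time muln_gt0; lia.
  by move: Ht; rewrite E; clear; lia.
Qed.

Hypothesis lL : 32 * (max_degree G * log n) <= l.

Definition round_time : nat := k * group_time + 5 * (n + m) + 20.

Lemma round_spec base rt s :
  statics s -> routing_inv base rt s -> z < reg s 7 ->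
  spec w round s (fun t s' =>
    [/\ exists rt', routing_inv (base + cap n l) rt' s',
        reg s' 9 != 0 -> cut_inv n s' /\ good_cut (in_cut n s'),
        reg s' 9 = 0 -> reg s' 7 <= z \/ 2 * reg s' 7 <= reg s 7
      & t <= round_time]).
Proof.
move=> Hst RI zN; have lin := word_linear word; have w1 : 1 < 2 ^ w by apply: lin; lia.
have totn := double_total disj AB.
have n1 : 1 < n by have [_ _ _ [_ _ C3] _] := RI; lia.
rewrite /round; apply: (spec_seq_same (reset_spec Hst RI)) => t1 s1 S1.
move=> [RI1 RX1 E8 Sum Ht1].
have Hst1 : statics s1 by apply: (statics_same S1).
apply: (spec_seq_same (groups_spec Hst1 n1 RI1 RX1)) => t2 s2 S2 [[rt2 RI2] RX2 Ht2].
have E4 : reg s2 4 = z by rewrite S2.1 // S1.1 //; case: Hst => [[]].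
have E8' : reg s2 8 = reg s 7 by rewrite S2.1.
have [ev HX X1 X5 _] := RX2.
have [_ _ _ [_ _ N2] _] := RI2.
have [_ _ _ evS] := ev; rewrite Sum S1.1 // in evS.
apply: spec_assign.
  rewrite /=; fits_split=> //; try by apply: lin; lia.
rewrite /= E4 E8' nat_bool_muln; set s3 := set_reg _ _ _.
have RI3 : routing_inv (base + cap n l) rt2 s3.
  have [_ [_ _ _ _ [H3 H4]] _ _ _] := RI2.
  (* Only register 9 differs, so a dummy assignment to it serves as the command of the frame
     condition. *)
  apply: (@routing_inv_same _ _ _ _ _ _ _ _ _ (Assign 9 (Num 0)) s2 _ _ _ _ _ _ RI2) => //.
  by split=> // x; rewrite inE => /negbTE /= ->.
split=> //; first by exists rt2.
- move=> /nat_bool_neq0 /andP [zN' Ns]; split=> //.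
  have -> : in_cut n s3 = in_cut n s2 by [].
  have := unrouted_bound RI2 RX2.
  set X := in_cut n s2 in X1 X5 *; set N := reg s2 7 in N2 zN' Ns evS * => HN.
  have Nn : 2 * N <= n by move: N2 totn; clear; lia.
  have cX : #|X| + #|~: X| = n by rewrite cardsC card_ord.
  have L0 : 0 < log n by rewrite /log trunc_log_gt0.
  have N2X : N <= 2 * #|X| by case: (ltnP (4 * #|X|) n) => [/HN|]; move: Nn; clear; lia.
  split.
  + by rewrite -cards_eq0; move: N2X zN'; clear; lia.
  + by rewrite -cards_eq0; move: cX X5 n1; clear; lia.
  + by move: N2X zN'; clear; lia.
  + by move: cX X5 Nn zN'; clear; lia.
  + apply: (sparse_cut (r := mem s2 10) (N := N) (N0 := reg s 7)) => //.
      by move: evS; rewrite mulnBr -/(cap n l); clear; lia.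
    by move=> e em; case: RI2 => _ _ _ _ /(_ (Ordinal em)) [].
- move=> /nat_bool_eq0; rewrite negb_and -!leqNgt; case/orP => H; [left|right]; lia.
- by move: Ht1 Ht2; rewrite /round_time; clear; lia.
Qed.

End Rounds.

(** * The whole program *)

Definition read_arcs : cmd :=
  Assign 16 (Num 1) ;;
  While (Bin Lt (Reg 16) (Bin Add (Bin Mul (Num 2) (Reg 1)) (Num 1)))
    (Assign 18 (Bin Div (Bin Sub (Reg 16) (Num 1)) (Num 2)) ;;
     If (Bin Mod (Reg 16) (Num 2))
       (Assign 15 (Read 0 (Reg 18)) ;; Assign 17 (Read 1 (Reg 18)))
       (Assign 15 (Read 1 (Reg 18)) ;; Assign 17 (Read 0 (Reg 18))) ;;
     Store 6 (Reg 16) (Read 7 (Reg 15)) ;;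
     Store 7 (Reg 15) (Reg 16) ;;
     Store 5 (Reg 16) (Reg 17) ;;
     Assign 16 (Bin Add (Reg 16) (Num 1))).

Definition read_labels : cmd :=
  Assign 12 (Num 0) ;;
  While (Bin Lt (Reg 12) (Reg 0))
    (Store 8 (Reg 12) (Read 2 (Reg 12)) ;;
     Store 9 (Reg 12) (Read 3 (Reg 12)) ;;
     If (Read 2 (Reg 12)) (Assign 7 (Bin Add (Reg 7) (Num 1))) Skip ;;
     Assign 12 (Bin Add (Reg 12) (Num 1))).

Definition setup : cmd := log_prog ;; read_arcs ;; read_labels.

Definition output : cmd :=
  If (Reg 9)
    (Assign 15 (Num 0) ;;
     While (Bin Lt (Reg 15) (Reg 0))
       (Store 0 (Reg 15) (Read 11 (Reg 15)) ;; Assign 15 (Bin Add (Reg 15) (Num 1))) ;;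
     Assign 0 (Num 1))
    (Assign 1 (Reg 19) ;; Assign 0 (Num 0)).

Definition program : cmd := setup ;; main_loop ;; output.

(** Each round that halves the remaining sources lowers this logarithm, which thus bounds the number
    of rounds left. *)
Lemma trunc_log_half x y : 0 < x -> 2 * x <= y -> trunc_log 2 x < trunc_log 2 y.
Proof.
move=> x0 xy; apply: trunc_log_max => //; rewrite expnS.
by apply: leq_trans xy; rewrite leq_mul2l trunc_logP.
Qed.

Section Main.
Variables (n m k : nat) (G : multigraph n m) (A B : 'I_k -> {set 'I_n}).
Variables (z l w : nat).
Hypothesis word : big_word n m k l z w.

Local Notation statics := (statics k G z l).
Local Notation routing_inv := (routing_inv G A B l).
Local Notation round_time := (round_time n m k l).

Lemma read_arcs_spec s :
  reg s 1 = m ->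
  (forall e, mem s 0 e = nth 0 (end1s G) e) -> (forall e, mem s 1 e = nth 0 (end2s G) e) ->
  (forall v, mem s 7 v = 0) ->
  spec w read_arcs s (fun t s' =>
    [/\ adj_lists n (2 * m) (arc_tl G) (mem s' 7) (mem s' 6),
        forall p, is_arc m p -> mem s' 5 p = arc_hd G p
      & t <= 20 * m + 10]).
Proof.
move=> E1 M0 M1 M7; have lin := word_linear word; have w1 : 1 < 2 ^ w by apply: lin; lia.
have w0 : 0 < 2 ^ w by apply: ltnW.
rewrite /read_arcs; apply: spec_seq_assign => //; set s1 := set_reg _ _ _.
pose I p s' := adj_lists n p.-1 (arc_tl G) (mem s' 7) (mem s' 6) /\
  forall q, 0 < q < p -> mem s' 5 q = arc_hd G q.
apply: spec_conseq (@spec_for w 16 _ _ s1 1 (2 * m).+1 9 I (fun=> 0) _ _ _ w1 _ _) _ => //.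
- split; last by move=> q; lia.
  split=> [v vn|p]; last by rewrite /=; lia.
  by rewrite /= M7; split=> // p; lia.
- move=> s' S; have E1' : reg s' 1 = m by rewrite S.1.
  by split; [fits_split=> //; rewrite ?E1'; apply: lin; lia | rewrite /= E1' addn1].
- move=> s' [//|p] S [Hadj Hhd] _; rewrite ltnS => pm E16.
  have M0' : mem s' 0 = mem s 0 by rewrite S.2.
  have M1' : mem s' 1 = mem s 1 by rewrite S.2.
  have Hp : is_arc m p.+1 by rewrite /is_arc.
  apply: spec_seq_assign; first by fits_split=> //; apply: lin; lia.
  rewrite /= E16 -/(arc_edge p.+1); set s2 := set_reg _ 18 _.
  apply: (@spec_seq_same _ _ _ _ (fun t s3 =>
     [/\ reg s3 15 = arc_tl G p.+1, reg s3 17 = arc_hd G p.+1 & t <= 3])).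
    apply: spec_if => /=; rewrite ?E16.
    + by fits_split=> //; apply: lin; lia.
    + rewrite modn2 => /nat_bool_neq0 podd; apply: spec_seq_assign => //; apply: spec_assign => //.
      by rewrite /= M0' M1' M0 M1 /arc_tl /arc_hd podd.
    + rewrite modn2 => /nat_bool_eq0 podd; apply: spec_seq_assign => //; apply: spec_assign => //.
      by rewrite /= M0' M1' M0 M1 /arc_tl /arc_hd (negbTE podd).
  move=> t s3 S3 [E15 E17 Ht].
  have E16' : reg s3 16 = p.+1 by rewrite S3.1.
  do 3 apply: spec_seq_store => //.
  apply: spec_assign; first by fits_split=> //; rewrite E16'; apply: lin; lia.
  rewrite /= E15 E16' E17 addn1; split=> //; last by move: Ht; clear; lia.
  have M7' : mem s3 7 = mem s' 7 by rewrite S3.2.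
  have M6' : mem s3 6 = mem s' 6 by rewrite S3.2.
  have M5' : mem s3 5 = mem s' 5 by rewrite S3.2.
  split.
    have := adj_lists_rcons Hadj (arc_tl_lt G Hp).
    by rewrite /= -M7' -M6'.
  move=> q /andP [q0]; rewrite ltnS leq_eqVlt => /orP [/eqP ->|Hq] /=.
    by rewrite eqxx.
  by rewrite ltn_eqF // M5' Hhd // q0.
- move=> t s' [S [Hadj Hhd] _ Ht]; split=> //.
  by move: Ht; clear; lia.
Qed.

Lemma label_eq (C : 'I_k -> {set 'I_n}) (v : 'I_n) (i : 'I_k) :
  (forall i j, i != j -> [disjoint C i & C j]) ->
  (label C v == i.+1) = (v \in C i).
Proof.
move=> D; rewrite /label; case: pickP => [j vj|none].
  rewrite eqSS; case: (eqVneq (val j) i) => [/val_inj <-|H]; first by rewrite vj.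
  by rewrite (disjointFr (D j i H) vj).
by rewrite none.
Qed.

Lemma label_neq0 (C : 'I_k -> {set 'I_n}) (v : 'I_n) :
  (label C v != 0) = (v \in \bigcup_i C i).
Proof.
rewrite /label; case: pickP => [j vj|none] /=.
  by symmetry; apply/bigcupP; exists j.
by symmetry; apply/bigcupP => -[j _]; rewrite none.
Qed.

Definition labels_read (s : state) : Prop :=
  [/\ forall v : 'I_n, mem s 8 v = label A v, forall v : 'I_n, mem s 9 v = label B v
    & reg s 7 = #|\bigcup_i A i|].

Lemma read_labels_spec s :
  reg s 0 = n -> reg s 7 = 0 ->
  (forall v : 'I_n, mem s 2 v = label A v) -> (forall v : 'I_n, mem s 3 v = label B v) ->
  spec w read_labels s (fun t s' => labels_read s' /\ t <= 7 * n + 2).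
Proof.
move=> E0 E7 M2 M3; have lin := word_linear word; have w1 : 1 < 2 ^ w by apply: lin; lia.
have w0 : 0 < 2 ^ w by apply: ltnW.
rewrite /read_labels; apply: spec_seq_assign => //; set s1 := set_reg _ _ _.
pose P (v : 'I_n) := label A v != 0.
pose I b s' := [/\ forall v : 'I_n, v < b -> mem s' 8 v = label A v /\ mem s' 9 v = label B v
  & reg s' 7 = #|[set v : 'I_n | P v && (v < b)]|].
apply: spec_conseq (@spec_for w 12 _ _ s1 0 n 6 I (fun=> 0) _ _ _ w1 _ _) _ => //.
- split=> //=; rewrite E7; apply/esym/eqP; rewrite cards_eq0; apply/eqP/setP => v.
  by rewrite !inE andbF.
- by move=> s' S; split=> //=; rewrite S.1.
- move=> s' b S [Hl E7'] _ bn E12; pose vb := Ordinal bn.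
  have M2' : mem s' 2 b = label A vb by rewrite S.2 //= (M2 vb).
  have M3' : mem s' 3 b = label B vb by rewrite S.2 //= (M3 vb).
  have Pn : #|[set v : 'I_n | P v && (v < b)]| <= n by rewrite -[leqRHS]card_ord max_card.
  do 2 apply: spec_seq_store => //=; rewrite E12 M2' M3'; set s2 := set_mem _ 9 _ _.
  have H12 : reg s2 12 = b by [].
  have H2 : mem s2 2 b = label A vb by [].
  apply: (@spec_seq_same _ _ _ _ (fun t s3 =>
     reg s3 7 = #|[set v : 'I_n | P v && (v < b.+1)]| /\ t <= 2)).
    rewrite (card_lt_rcons _ bn) -/vb -E7' /P.
    apply: spec_if => //=; rewrite E12 M2' => Hv.
    + by apply: spec_assign; [fits_split=> //=; rewrite E7'; apply: lin; lia | rewrite /= Hv].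
    + by apply: spec_skip; rewrite /= Hv addn0.
  move=> t s3 S3 [E73 Ht]; have E12' : reg s3 12 = b by rewrite S3.1.
  apply: spec_assign; first by fits_split=> //; rewrite E12'; apply: lin; lia.
  rewrite /= E12' addn1; split=> //; last by move: Ht; clear; lia.
  split=> // v; rewrite ltnS leq_eqVlt /= !S3.2 //= => /orP [/eqP E|vlt].
    by rewrite E eqxx; have -> : v = vb by apply: val_inj.
  by rewrite ltn_eqF //; apply: Hl.
- move=> t s' [S [Hl E7'] _ Ht]; split; last by move: Ht; clear; lia.
  split; [by move=> v; apply: (Hl v _).1 | by move=> v; apply: (Hl v _).2 |].
  rewrite E7'; apply: eq_card => v.
  by rewrite inE ltn_ord andbT /P label_neq0.
Qed.

Lemma output_spec s :
  reg s 0 = n ->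
  spec w output s (fun t s' =>
    [/\ reg s 9 != 0 -> reg s' 0 = 1 /\ (forall v, v < n -> mem s' 0 v = mem s 11 v),
        reg s 9 = 0 -> [/\ reg s' 0 = 0, reg s' 1 = reg s 19 & mem s' = mem s]
      & t <= 3 * n + 5]).
Proof.
move=> E0; have lin := word_linear word; have w1 : 1 < 2 ^ w by apply: lin; lia.
have w0 : 0 < 2 ^ w by apply: ltnW.
rewrite /output; apply: spec_if => //= F; last first.
  apply: spec_seq_assign => //; apply: spec_assign => //=.
  by rewrite F; split=> //; lia.
apply: spec_seq_assign => //; set s1 := set_reg _ _ _.
pose I j s' := forall v, v < j -> mem s' 0 v = mem s 11 v.
apply: (@spec_seq_same _ _ _ _ (fun t s' => I n s' /\ t <= 3 * n + 1)).
  apply: spec_conseq (@spec_for w 15 _ _ s1 0 n 2 I (fun=> 0) _ _ _ w1 _ _) _ => //.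
  - by move=> s' S; split=> //=; rewrite S.1.
  - move=> s' v S HI _ vn E15; apply: spec_seq_store => //.
    apply: spec_assign; first by fits_split=> //; apply: lin; lia.
    rewrite /= E15 addn1; split=> // v'; rewrite ltnS leq_eqVlt => /orP [/eqP ->|vv] /=.
      by rewrite eqxx S.2.
    by rewrite ltn_eqF //; apply: HI.
  - by move=> t s' [S HI _ Ht]; split=> //; move: Ht; clear; lia.
move=> t s2 S2 [HI Ht]; apply: spec_assign => //=.
split=> //; last by move: Ht; clear; lia.
by move=> F0; rewrite F0 in F.
Qed.

Hypothesis n0 : 0 < n.
Hypothesis disj : disjoint_family A B.
Hypothesis AB : forall i, #|A i| <= #|B i|.

Lemma setup_spec :
  spec w setup (input G A B z l) (fun t s =>
    [/\ statics s, routing_inv 0 [::] s, reg s 9 = 0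
      & t <= 3 * log n + 20 * m + 7 * n + 20]).
Proof.
have lin := word_linear word; have w1 : 1 < 2 ^ w by apply: lin; lia.
have [D1 D2 D3] := disj.
set s0 := input _ _ _ _ _.
have nW : n.+1 < 2 ^ w by apply: lin; lia.
have lW : l * l < 2 ^ w by apply: (word_mul1 word); lia.
rewrite /setup; apply: (spec_seq_same (log_spec (s := s0) n0 nW lW _ _ _)) => //.
move=> t1 s1 S1 [E5 E6 Ht1].
have s0a a i : 3 < a -> mem s0 a i = 0.
  by case: a => [|[|[|[|a]]]] // _; rewrite /= !nth_nil.
have s0r x : 4 < x -> reg s0 x = 0.
  by case: x => [|[|[|[|[|x]]]]] // _; rewrite /= nth_nil.
apply: spec_seq_same.
  apply: read_arcs_spec.
  - by rewrite S1.1.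
  - by move=> e; rewrite S1.2.
  - by move=> e; rewrite S1.2.
  - by move=> v; rewrite S1.2 // s0a.
move=> t2 s2 S2 [Hadj Hhd Ht2].
apply: spec_conseq (spec_same (@read_labels_spec s2 _ _ _ _)) _.
- by rewrite S2.1 // S1.1.
- by rewrite S2.1 // S1.1.
- by move=> v; rewrite S2.2 // S1.2 //= (nth_map v) ?size_enum_ord // nth_ord_enum.
- by move=> v; rewrite S2.2 // S1.2 //= (nth_map v) ?size_enum_ord // nth_ord_enum.
move=> t3 s3 [S3 [[L1 L2 E7] Ht3]].
split.
- split; rewrite ?S3.1 ?S3.2 ?S2.1 //.
  by rewrite !S1.1.
- have R19 x : x \in [:: 19; 20] -> reg s3 x = 0.
    by rewrite !inE => /orP [] /eqP ->; rewrite S3.1 // S2.1 // S1.1.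
  have clsA (i : 'I_k) : cls n (mem s3 8) i = #|A i|.
    by apply: eq_card => v; rewrite inE L1 label_eq.
  have clsB (i : 'I_k) : cls n (mem s3 9) i = #|B i|.
    by apply: eq_card => v; rewrite inE L2 label_eq.
  split=> //.
  + by split; rewrite ?R19.
  + move=> v i; rewrite L1 L2; split.
      by move/eqP; rewrite label_eq.
    by move/eqP; rewrite label_eq.
  + rewrite E7 addn0 card_bigcup_disjoint //; split=> //.
      by move=> i ik; rewrite (clsA (Ordinal ik)) (clsB (Ordinal ik)).
    by apply: eq_bigr => i _; rewrite clsA.
  + move=> e; have -> : mem s3 10 e = 0 by rewrite S3.2 // S2.2 // S1.2 // s0a.
    by [].
- by rewrite S3.1 // S2.1 // S1.1.
- by move: Ht1 Ht2 Ht3; rewrite /log; clear; lia.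
Qed.

Hypothesis l0 : 0 < l.
Hypothesis lL : 32 * (max_degree G * log n) <= l.

Lemma main_loop_spec s :
  statics s -> routing_inv 0 [::] s -> reg s 9 = 0 ->
  spec w main_loop s (fun t s' =>
    [/\ exists rt, routing_inv (l * l) rt s',
        reg s' 9 != 0 -> cut_inv n s' /\ good_cut G z l (in_cut n s'),
        reg s' 9 = 0 -> reg s' 7 <= z
      & t <= log n * round_time.+2 + 1]).
Proof.
move=> Hst RI F0; have lin := word_linear word; have w1 : 1 < 2 ^ w by apply: lin; lia.
have w0 : 0 < 2 ^ w by apply: ltnW.
have totn := double_total disj AB.
pose active s := (reg s 9 == 0) && (z < reg s 7).
(* [c] counts the finished rounds, each granting [cap] to every edge; while the loop is active, the
   rounds still possible fit within [log n]. *)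
pose I s' := exists c rt, [/\ routing_inv (c * cap n l) rt s', c <= log n,
  active s' -> c + (trunc_log 2 (reg s' 7)).+1 <= log n
  & reg s' 9 != 0 -> cut_inv n s' /\ good_cut G z l (in_cut n s')].
pose mu s' := if active s' then round_time.+2 * (trunc_log 2 (reg s' 7)).+1 else 0.
have Hlog : active s -> trunc_log 2 (reg s 7) < log n.
  case/andP=> _ zN; apply: trunc_log_half; first exact: leq_ltn_trans zN.
  by case: RI => _ _ _ [_ _ N2] _; move: N2; rewrite addn0 => ->.
have statE s' : same main_loop s s' -> statics s'.
  by move=> S; apply: (statics_same S).
have guardE s' : statics s' ->
    evalN s' (Bin Mul (Bin Eq (Reg 9) (Num 0)) (Bin Lt (Reg 4) (Reg 7))) = active s'.
  by move=> [[_ _ _ _ E4] _ _ _ _]; rewrite /= E4 nat_bool_muln.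
rewrite /main_loop.
apply: spec_conseq (@spec_while w _ _ s I mu _ _ _) _.
- by exists 0, [::]; split=> //; rewrite F0.
- move=> s' _ _; fits_split=> //; by apply: lin; lia.
- move=> s' /statE Hst' [c [rt [RI' cL Hact _]]]; rewrite guardE // => /nat_bool_neq0 act.
  have zN : z < reg s' 7 by case/andP: act.
  have {Hact} := Hact act => Hact.
  apply: spec_conseq (round_spec word disj AB l0 lL Hst' RI' zN) _.
  move=> t s2 [[rt2 RI2] Hcut Hcont Ht].
  have step : active s2 -> trunc_log 2 (reg s2 7) < trunc_log 2 (reg s' 7).
    case/andP => /eqP F2 zN2; apply: trunc_log_half; first exact: leq_ltn_trans zN2.
    by case: (Hcont F2) => //; rewrite leqNgt zN2.
  split.
    exists c.+1, rt2; split=> //; [|lia|].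
      by rewrite mulSn addnC.
    by move=> /step; lia.
  rewrite /mu act; case: (boolP (active s2)) => [/step H|_].
    have H2 : round_time.+2 * (trunc_log 2 (reg s2 7)).+1 <=
              round_time.+2 * trunc_log 2 (reg s' 7) by rewrite leq_mul2l H orbT.
    by move: H2 Ht; rewrite [_ * (trunc_log 2 (reg s' 7)).+1]mulnS; clear; lia.
  by move: Ht; rewrite mulnS; clear; lia.
- move=> t s' [/statE Hst' [c [rt [RI' cL Hact Hcut]]]]; rewrite guardE //.
  move=> /nat_bool_eq0 nact Ht; split=> //.
  (* At most [log n] rounds of [l * l / log n] units each give congestion at most [l * l]. *)
  + exists rt; case: RI' => H1 H2 H3 H4 H5; split=> // e; have [H6 H7] := H5 e.
    split=> //; apply: leq_trans H7 _; apply: (@leq_trans (log n * cap n l)).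
      by rewrite leq_mul2r cL orbT.
    by rewrite mulnC leq_divM.
  + by move=> F; move: nact; rewrite /active F eqxx /= -leqNgt.
  + move: Ht; rewrite {2}/mu; case: ifP => [/Hlog H|_]; last by clear; lia.
    have H2 : round_time.+2 * (trunc_log 2 (reg s 7)).+1 <= round_time.+2 * log n.
      by rewrite leq_mul2l H orbT.
    by move: H2; rewrite [log n * _]mulnC; clear; lia.
Qed.

End Main.

(** * Extracting the output *)

Section Extract.
Variables (n m k : nat) (G : multigraph n m) (A B : 'I_k -> {set 'I_n}) (l : nat).
Hypothesis disj : disjoint_family A B.

Local Notation route := (route n m).

(** Routes are stored without the index of their pair of sets; it is recovered from the source,
    which lies in only one [A i]. *)
Definition pairs_of (rt : seq route) (i : 'I_k) : {set 'I_n * 'I_n} :=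
  [set p | (p \in unzip1 rt) && (p.1 \in A i)].

Definition path_of (rt : seq route) (p : 'I_n * 'I_n) : seq ('I_m * 'I_n) :=
  nth [::] (unzip2 rt) (index p (unzip1 rt)).

Lemma valid_uniq rt : valid_routes G A B l rt -> uniq (unzip1 rt).
Proof.
move=> [_ U _]; apply: (@map_uniq _ _ fst); rewrite /unzip1 -map_comp.
exact: U.
Qed.

Lemma path_of_route rt (x : route) : uniq (unzip1 rt) -> x \in rt -> path_of rt x.1 = x.2.
Proof.
elim: rt => //= y rt IH /andP [N U]; rewrite inE => /orP [/eqP ->|xrt].
  by rewrite /path_of /= eqxx.
have Nx : y.1 != x.1 by apply: contraNneq N => ->; apply: map_f.
by rewrite -IH // /path_of /= (negbTE Nx).
Qed.

Lemma map_path_of rt : uniq (unzip1 rt) -> [seq path_of rt p | p <- unzip1 rt] = unzip2 rt.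
Proof.
by move=> U; rewrite -map_comp; apply/eq_in_map => x xrt; apply: path_of_route.
Qed.

Lemma all_pairs_of rt : valid_routes G A B l rt -> all_pairs (pairs_of rt) =i unzip1 rt.
Proof.
move=> [H _ _] p; apply/bigcupP/idP => [[i _]|prt]; first by rewrite inE => /andP [].
have /mapP [x xrt Ex] := prt; have [_ _ [i [Hi _]]] := H x xrt.
by exists i => //; rewrite inE prt Ex.
Qed.

Lemma routing_valid rt : valid_routes G A B l rt ->
  is_partial_routing G A B (pairs_of rt) (path_of rt).
Proof.
move=> VR; have U := valid_uniq VR; have [H U1 U2] := VR; have [D1 D2 D3] := disj.
split=> [i|p]; last first.
  rewrite all_pairs_of // => /mapP [x xrt ->]; rewrite path_of_route //.
  by have [] := H x xrt.
split.
  apply/subsetP => p; rewrite !inE => /andP [/mapP [x xrt ->] Ai].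
  rewrite Ai /=; have [_ _ [j [Aj Bj]]] := H x xrt.
  by case: (eqVneq i j) => [-> //|ij]; rewrite (disjointFr (D2 i j ij) Ai) in Aj.
have inj (T : eqType) (f : route -> T) (x y : route) :
    uniq [seq f u | u <- rt] -> x \in rt -> y \in rt -> x.1 != y.1 -> f x != f y.
  move=> Uf xrt yrt; apply: contraNneq => E.
  have /= := nth_uniq (f x) _ _ Uf; move: (xrt) (yrt); rewrite -!index_mem => ix iy.
  rewrite -(size_map f) in ix; rewrite -(size_map f) in iy.
  move=> /(_ _ _ ix iy); rewrite !(nth_map x) -?(size_map f) // !nth_index // E eqxx.
  by move/esym/eqP => Ei; rewrite -(nth_index x xrt) Ei nth_index.
move=> p q; rewrite !inE => /andP [/mapP [x xrt ->] _] /andP [/mapP [y yrt ->] _] ne.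
split; first exact: (inj _ (fun u : route => u.1.1)).
exact: (inj _ (fun u : route => u.1.2)).
Qed.

Lemma routing_value_size rt : valid_routes G A B l rt ->
  routing_value (pairs_of rt) = size rt.
Proof.
move=> VR; have U := valid_uniq VR; have [_ D2 _] := disj.
rewrite /routing_value -card_bigcup_disjoint.
  rewrite -(size_map fst) -(card_uniqP U); apply: eq_card => p.
  exact: all_pairs_of.
move=> i j ij; rewrite -setI_eq0; apply/eqP/setP => p; rewrite !inE.
case: (p \in unzip1 rt) => //=; apply/negP => /andP [Hi Hj].
by rewrite (disjointFr (D2 i j ij) Hi) in Hj.
Qed.

Lemma routing_congestion rt c : valid_routes G A B l rt ->
  (forall e : 'I_m, count (fun x : route => e \in unzip1 x.2) rt <= c) ->
  causes_congestion (pairs_of rt) (path_of rt) c.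
Proof.
move=> VR Hc e; have U := valid_uniq VR; apply: leq_trans (Hc e).
have -> : count (fun x : route => e \in unzip1 x.2) rt =
    count (fun p => e \in unzip1 (path_of rt p)) (unzip1 rt).
  rewrite count_map; apply: eq_in_count => x xrt /=; by rewrite path_of_route.
rewrite -size_filter -(card_uniqP _) ?filter_uniq //.
apply: eq_leq; apply: eq_card => p; rewrite inE all_pairs_of // mem_filter andbC.
by [].
Qed.

Lemma routing_output rt s : valid_routes G A B l rt -> stored rt s ->
  forall s', reg s' 0 = 0 -> reg s' 1 = reg s 19 -> mem s' = mem s ->
  outputs_routing s' (pairs_of rt) (path_of rt).
Proof.
move=> VR [E19 _ [S0 S1] S2 [S3 S4]] s' E0 E1 M; have U := valid_uniq VR.
split=> //; exists (unzip1 rt); split=> //; split.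
  by move=> p; rewrite all_pairs_of.
have E2 : [seq size (path_of rt p) | p <- unzip1 rt] = [seq size x.2 | x : route <- rt].
  by rewrite (map_comp size (path_of rt)) map_path_of // /unzip2 -map_comp.
split; first by rewrite E1 E19 size_map.
rewrite E2 map_path_of // /array_holds M /unzip1 -!map_comp.
by do 4 split=> //.
Qed.

End Extract.

(** * Logarithm, word size and running time *)

Lemma trunc_log_le_log2 (R : realType) (n : nat) : 0 < n ->
  ((trunc_log 2 n)%:R <= log2 R n)%R.
Proof.
move=> n0; have ln2 : (0 < ln 2 :> R)%R by apply: ln_gt0; rewrite ltr1n.
rewrite /log2 ler_pdivlMr // mulr_natl -lnXn ?ltr0n // ler_ln ?posrE ?exprn_gt0 ?ltr0n //.
by rewrite -natrX ler_nat trunc_logP.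
Qed.

(** Six of the eight powers of [s >= 3] give a factor 729, which absorbs the 20 and the shift by
    10. *)
Lemma word_size (s w : nat) : 2 < s -> s ^ 8 <= 2 ^ w -> 20 * (s + 10) ^ 2 < 2 ^ w.
Proof.
move=> s3; apply: leq_trans.
have H : 20 * (s + 10) ^ 2 < 3 ^ 6 * s ^ 2 by nia.
apply: leq_trans H _; rewrite -[8]/(6 + 2) expnD leq_mul2r.
by rewrite leq_exp2r // s3 orbT.
Qed.

(** A round takes O(k l (n + m)), which is O([Q]) as [l >= 1]. The summand 1 in [1 + L] pays for the
    linear work outside the rounds, also when [L = 0]. *)
Lemma time_bound (n m k l L t1 t2 t3 : nat) : 0 < n -> 0 < k -> 0 < l ->
  t1 <= 3 * L + 20 * m + 7 * n + 20 ->
  t2 <= L * (round_time n m k l).+2 + 1 -> t3 <= 3 * n + 5 ->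
  t1 + (t2 + t3) <= 1600 * (l ^ 3 * k * m + l ^ 2 * k * n) * (1 + L).
Proof.
move=> n0 k0 l0 H1 H2 H3; set Q := _ + _ * n.
have kl : 0 < k * l by rewrite muln_gt0 k0.
have Qge : k * (l * (n + m)) <= Q.
  rewrite /Q !mulnDr addnC; apply: leq_add.
    by rewrite !expnS expn0 muln1; nia.
  by rewrite !expnS expn0 muln1; nia.
have Q1 : k * l <= Q.
  by apply: leq_trans Qge; rewrite leq_mul2l leq_pmulr ?orbT //; lia.
have Q2 : n + m <= Q.
  by apply: leq_trans Qge; rewrite mulnA leq_pmull.
have Hg : k * group_time n m l <= 1440 * Q.
  rewrite /group_time; apply: (@leq_trans (240 * (2 * (k * (l * (n + m))) + 4 * (k * l)))).
    nia.
  by move: Qge Q1; clear; lia.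
have Hr : (round_time n m k l).+2 <= 1500 * Q.
  by rewrite /round_time; move: Hg Q1 Q2 kl; clear; lia.
have Hl : L * (round_time n m k l).+2 <= L * (1500 * Q) by rewrite leq_mul2l Hr orbT.
have QL : L <= L * Q by rewrite leq_pmulr //; move: Q1 kl; clear; lia.
rewrite mulnDr muln1 [1600 * Q * L]mulnC.
move: H1 H2 H3 Hl QL Q1 Q2 kl; clear; move: (round_time _ _ _ _) => r.
rewrite !(mulnCA L); move: (L * Q) (L * r.+2) => x y; lia.
Qed.

Theorem theorem3p2 :
  exists (alg : cmd) (b C d : nat),
  forall (R : realType) (n m k : nat) (G : multigraph n m)
    (A B : 'I_k -> {set 'I_n}) (z l w : nat),
  0 < n -> 0 < k -> 0 < l ->
  disjoint_family A B ->
  (forall i, #|A i| <= #|B i|) ->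
  (32 * (max_degree G)%:R * log2 R n <= l%:R)%R ->
  (n + m + k + l + z) ^ b <= 2 ^ w ->
  exists (t : nat) (s : state),
    exec w alg (input G A B z l) t s /\
    (t%:R <= C%:R * (l ^ 3 * k * m + l ^ 2 * k * n)%:R * (1 + log2 R n) ^+ d)%R /\
    ((exists (M : 'I_k -> {set 'I_n * 'I_n})
             (P : 'I_n * 'I_n -> seq ('I_m * 'I_n)),
        is_partial_routing G A B M P /\
        \sum_(i < k) #|A i| <= routing_value M + z /\
        causes_congestion M P (l ^ 2) /\
        outputs_routing s M P)
     \/
     (exists X Y : {set 'I_n},
        is_cut X Y /\
        (z%:R / 2 <= #|X|%:R :> R)%R /\
        (z%:R / 2 <= #|Y|%:R :> R)%R /\
        (sparsity G R X Y <= 72 * (max_degree G)%:R * log2 R n / l%:R)%R /\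
        outputs_cut s X)).
Proof.
(* The exponent 1 reflects that the number of rounds is the only logarithmic factor. *)
exists program, 8, 1600, 1 => R n m k G A B z l w n0 k0 l0 disj AB lD Hw.
(* Rounding the logarithm down preserves the assumption on [l], and the sparsity and time bounds in
   terms of [log n] imply those in terms of [log2 R n]. *)
have logR : ((log n)%:R <= log2 R n)%R := trunc_log_le_log2 R n0.
have lL : 32 * (max_degree G * log n) <= l.
  rewrite -(ler_nat R) !natrM mulrA; apply: le_trans lD.
  by rewrite ler_wpM2l // mulr_ge0.
have word : big_word n m k l z w by apply: word_size Hw; lia.
match goal with |- exists t s, exec ?w ?c ?s0 t s /\ @?Q t s =>
  change (spec w c s0 Q) end.
rewrite /program; apply: (spec_seq_same (setup_spec G word n0 disj AB)).
move=> t1 s1 _ [Hst RI F0 Ht1].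
apply: (spec_seq_same (main_loop_spec word n0 disj AB l0 lL Hst RI F0)).
move=> t2 s2 S2 [[rt RI2] Hcut Hroute Ht2].
have E0 : reg s2 0 = n by rewrite S2.1 //; case: Hst => [[]].
apply: spec_conseq (output_spec word E0) _ => t3 s3 [Ocut Oroute Ht3].
split.
  have H := time_bound n0 k0 l0 Ht1 Ht2 Ht3.
  rewrite expr1 -natrM; apply: (@le_trans _ _ (_ * (1 + log n))%:R%R).
    by rewrite ler_nat; exact: H.
  by rewrite natrM ler_wpM2l // natrD lerD2l.
case: (eqVneq (reg s2 9) 0) => F; [left | right].
- have [VR Sto _ [_ _ N2] Hc] := RI2.
  exists (pairs_of A rt), (path_of rt); split; first exact: (routing_valid disj VR).
  split.
    by rewrite (routing_value_size disj VR) -/(total A) -N2 addnC leq_add2l Hroute.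
  have [O0 O1 OM] := Oroute F.
  split; last exact: (routing_output VR Sto O0 O1 OM).
  apply: (routing_congestion VR) => e; rewrite -mulnn.
  by apply: leq_trans (Hc e).2; apply: leq_addr.
- have [[X1 _] [XN YN zX zY HE]] := Hcut F; set X := in_cut n s2 in XN YN zX zY HE.
  exists X, (~: X); have [O0 OM] := Ocut F.
  have two (a b : nat) : a <= 2 * b -> (a%:R / 2 <= b%:R :> R)%R.
    by move=> H; rewrite ler_pdivrMr ?ltr0n // -natrM ler_nat mulnC.
  have min0 : 0 < minn #|X| #|~: X| by rewrite leq_min !card_gt0 XN YN.
  split; first by split=> //; rewrite ?setUCr // -setI_eq0 setICr.
  do 2 (split; first exact: two).
  split; last first.
    split=> // v; rewrite size_map size_enum_ord => vn.
    rewrite OM // (nth_map (Ordinal vn)) ?size_enum_ord //.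
    have -> : nth (Ordinal vn) (enum 'I_n) v = Ordinal vn.
      by apply: val_inj; rewrite /= nth_enum_ord.
    by rewrite inE /=; have := X1 (Ordinal vn) => /=; case: (mem s2 11 v) => [|[|]].
  rewrite /sparsity ler_pdivrMr ?ltr0n // mulrAC ler_pdivlMr ?ltr0n //.
  apply: (@le_trans _ _ ((72 * log n * (max_degree G * minn #|X| #|~: X|))%:R)%R).
    by rewrite -natrM ler_nat mulnC.
  rewrite !natrM; set D := (max_degree G)%:R%R; set x := (minn _ _)%:R%R.
  rewrite [leRHS](_ : _ = 72%:R * log2 R n * (D * x))%R; last first.
    by rewrite [RHS]mulrA; congr (_ * _)%R; apply: mulrAC.
  by rewrite ler_wpM2r ?mulr_ge0 // ler_wpM2l.
Qed.
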